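(* Let $n\ge2$, let $M\ge0$ be an integer, and let $w:\mathbb{R}^{n-1}\to[0,1]$ be continuous with $w(y)=0$ when $|y|\le1$ and $w(y)=1$ when $|y|\ge2$. Let $f:\mathbb{R}^{n-1}\to\mathbb{R}$ be continuous with $$\int_{\mathbb{R}^{n-1}}\frac{|f(y')|\,dy'}{|y'|^{M+n}+1}<\infty.$$ Then the function $u(x)=D_M[wf](x)+D[(1-w)f](x)$ satisfies $$u\in C^2(\Pi_+)\cap C^0(\overline{\Pi}_+),$$ $$\Delta u=0,\quad x\in\Pi_+,$$ $$u=f,\quad x\in\partial\Pi_+,$$ $$u(x)=o\left(|x|^{M+1}\sec^{n-1}\theta\right)\qquad(x\in\Pi_+,\ |x|\to\infty).$$
   Context: Half space: $\Pi_+=\{x\in\mathbb{R}^n: x_n>0\}$. For $x\in\Pi_+$ let $y\in\mathbb{R}^{n-1}$ be the projection of $x$ onto $\partial\Pi_+$ (identified with $\mathbb{R}^{n-1}$), and let $\theta\in[0,\pi/2)$ be the angle between $x$ and the unit normal $\hat e_n$, so $x_n=|x|\cos\theta$, $|y|=|x|\sin\theta$. For $y'\in\mathbb{R}^{n-1}$, $\theta'\in[0,\pi]$ is the angle between $y$ and $y'$ (with $\theta'=\pi/2$ if $y=0$ or $y'=0$; when $n=2$, $\cos\theta'=\operatorname{sgn}(x_1y')$). Kernels: $K(\lambda,x,y')=\left[|y'-y|^2+x_n^2\right]^{-\lambda}$, and for $|y'|>0$ $$K_M(\lambda,x,y')=K(\lambda,x,y')-\sum_{m=0}^{M-1}\frac{|x|^m}{|y'|^{m+2\lambda}}C_m^\lambda(\sin\theta\cos\theta'),\qquad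 K_0=K,$$ where $C_m^\lambda$ are the Gegenbauer polynomials: $(1-2tz+z^2)^{-\lambda}=\sum_{m\ge0}z^mC_m^\lambda(t)$. With $\omega_n=\pi^{n/2}/\Gamma(1+n/2)$ and $\alpha_n=2/(n\omega_n)$, $$D[f](x)=\alpha_nx_n\int_{\mathbb{R}^{n-1}}f(y')K\left(\tfrac n2,x,y'\right)dy',\qquad D_M[f](x)=\alpha_nx_n\int_{\mathbb{R}^{n-1}}f(y')K_M\left(\tfrac n2,x,y'\right)dy'.$$ The integrals define $u$ on $\Pi_+$; as usual for classical solutions of the Dirichlet problem, membership in $C^0(\overline\Pi_+)$ and the values on $\partial\Pi_+$ refer to the continuous extension of $u$ to $\overline\Pi_+$. Order relations: $g(x)=o(\omega(x))$ ($x\in\Pi_+$, $|x|\to\infty$) means $\sup\{|g(x)|/\omega(x):x\in\Pi_+,|x|=r\}\to0$ as $r\to\infty$. *)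

(* Defs.v *)
From HB Require Import structures.
From mathcomp Require Import all_boot all_order all_algebra.
From mathcomp Require Import all_classical all_reals all_analysis.

Set Implicit Arguments.
Unset Strict Implicit.
Unset Printing Implicit Defensive.

Import Order.TTheory GRing.Theory Num.Theory.
Import numFieldNormedType.Exports.

Local Open Scope classical_set_scope.
Local Open Scope ring_scope.

(* Row vectors carry the sigma-algebra generated by the coordinate maps, as
   [n.-tuple T] does in the library; over a realType this is the Borel
   sigma-algebra of R^n. *)
Section measurable_row.
Context {d : measure_display} {T : sigmaRingType d} (n : nat).

Let coors : 'I_n -> 'rV[T]_n -> T := fun i v => v ord0 i.

Let row_set0 : g_sigma_preimage coors set0.
Proof. exact: sigma_algebra0. Qed.

Let row_setC A : g_sigma_preimage coors A -> g_sigma_preimage coors (~` A).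
Proof. exact: sigma_algebraC. Qed.

Let row_bigcup (F : _^nat) : (forall i, g_sigma_preimage coors (F i)) ->
  g_sigma_preimage coors (\bigcup_i (F i)).
Proof. exact: sigma_algebra_bigcup. Qed.

HB.instance Definition _ := @isMeasurable.Build (measure_tuple_display d)
  ('rV[T]_n) (g_sigma_preimage coors) row_set0 row_setC row_bigcup.

End measurable_row.

Section lebesgue_measure_row.
Context {R : realType}.

Definition row_cons n (p : measurableTypeR R * 'rV[R]_n) : 'rV[R]_n.+1 :=
  \row_i (if unlift ord0 i is Some j then p.2 ord0 j else p.1).

Definition row_uncons n (v : 'rV[R]_n.+1) : measurableTypeR R * 'rV[R]_n :=
  (v ord0 ord0, \row_j v ord0 (lift ord0 j)).

Lemma measurable_coord n (i : 'I_n) :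
  measurable_fun [set: 'rV[R]_n] (fun v => v ord0 i).
Proof.
move=> _ Y mY; rewrite setTI; apply: sub_sigma_algebra => /=.
rewrite -bigcup_seq/=; exists i => /=; first by rewrite mem_index_enum.
by exists Y => //; rewrite setTI.
Qed.

Lemma measurable_rowP d (T : measurableType d) n (f : T -> 'rV[R]_n) :
  (forall i, measurable_fun [set: T] (fun t => f t ord0 i)) ->
  measurable_fun [set: T] f.
Proof.
move=> mf _ A mA; rewrite setTI.
have : preimage_set_system [set: T] f
    (g_sigma_preimage (fun i (v : 'rV[R]_n) => v ord0 i)) (f @^-1` A).
  by exists A => //; rewrite setTI.
rewrite -g_sigma_preimage_comp; apply: smallest_sub.
  exact: sigma_algebra_measurable.
rewrite -bigcup_seq => B [/= i _] [C mC <-].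
exact: mf.
Qed.

Lemma measurable_row_cons n :
  measurable_fun [set: measurableTypeR R * 'rV[R]_n] (@row_cons n).
Proof.
apply: measurable_rowP => i; case: (unliftP ord0 i) => [j ->|->].
  rewrite (_ : (fun t => _) = (fun v : 'rV[R]_n => v ord0 j) \o snd).
    apply: measurableT_comp => //; exact: measurable_coord.
  by apply/funext => t /=; rewrite mxE liftK.
rewrite (_ : (fun t => _) = fst) //.
by apply/funext => t /=; rewrite mxE unlift_none.
Qed.

Lemma measurable_row_uncons n :
  measurable_fun [set: 'rV[R]_n.+1] (@row_uncons n).
Proof.
apply/measurable_fun_pairP; split => /=; first exact: measurable_coord.
apply: measurable_rowP => i.
rewrite (_ : (fun t => _) = fun v : 'rV[R]_n.+1 => v ord0 (lift ord0 i)).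
  exact: measurable_coord.
by apply/funext => t /=; rewrite mxE.
Qed.

Lemma row_consK n : cancel (@row_cons n) (@row_uncons n).
Proof.
move=> [a v]; rewrite /row_uncons !mxE unlift_none; congr pair.
by apply/rowP => j; rewrite !mxE liftK.
Qed.

Section cons_measure.
Variables (n : nat) (mu : {sigma_finite_measure set 'rV[R]_n -> \bar R}).
Local Open Scope ereal_scope.

Definition cons_measure : set 'rV[R]_n.+1 -> \bar R :=
  pushforward (@lebesgue_measure R \x mu) (@row_cons n).

Let m0 : {measure set 'rV[R]_n.+1 -> \bar R} :=
  measure_function_pushforward__canonical__measure_function_Measure
    (@lebesgue_measure R \x mu) (@measurable_row_cons n).

HB.instance Definition _ := isMeasure.Build _ _ _ cons_measure
  (measure0 m0) (measure_ge0 m0) (@measure_semi_sigma_additive _ _ _ m0).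

Let cons_measure_sigma_finite : sigma_finite setT cons_measure.
Proof.
have /sigma_finiteP[F [TF ndF Foo]] := sigma_finiteT (@lebesgue_measure R).
have /sigma_finiteP[G [TG ndG Goo]] := sigma_finiteT mu.
exists (fun k => @row_uncons n @^-1` (F k `*` G k)).
  apply/esym; rewrite -subTset => v _.
  have [i _ Fi] : (\bigcup_k F k) (row_uncons v).1 by rewrite -TF.
  have [j _ Gj] : (\bigcup_k G k) (row_uncons v).2 by rewrite -TG.
  exists (maxn i j) => //; split => /=.
    by move: Fi; apply/subsetPset/ndF/leq_maxl.
  by move: Gj; apply/subsetPset/ndG/leq_maxr.
move=> k; have [mF Fk] := Foo k; have [mG Gk] := Goo k; split.
  rewrite -[X in measurable X]setTI.
  by apply: measurable_row_uncons => //; exact: measurableX.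
rewrite /cons_measure /pushforward -comp_preimage.
rewrite (_ : _ \o _ = id); last by apply/funext => p /=; rewrite row_consK.
by rewrite preimage_id product_measure1E// lte_mul_pinfty// ge0_fin_numE.
Qed.

HB.instance Definition _ := Measure_isSigmaFinite.Build _ _ _ cons_measure
  cons_measure_sigma_finite.
End cons_measure.

Fixpoint lebesgue_row n : {sigma_finite_measure set 'rV[R]_n -> \bar R} :=
  if n is m.+1 then cons_measure (lebesgue_row m) else \d_(0 : 'rV[R]_0).
End lebesgue_measure_row.

Section euclidean.
Context {R : realType}.

(* The library norm on matrices is the sup norm; it induces the same topology
   as the Euclidean norm but cannot be used in the formulas. *)
Definition edot n (u v : 'rV[R]_n) : R := \sum_i u ord0 i * v ord0 i.

Definition enorm n (v : 'rV[R]_n) : R := Num.sqrt (edot v v).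

Definition vangle n (u v : 'rV[R]_n) : R :=
  if (u == 0) || (v == 0) then pi / 2
  else acos (edot u v / (enorm u * enorm v)).

Definition pderive n (i : 'I_n) (u : 'rV[R]_n -> R) : 'rV[R]_n -> R :=
  'D_(delta_mx ord0 i) u.

Definition continuous_on n (A : set 'rV[R]_n) (u : 'rV[R]_n -> R) : Prop :=
  forall x, A x -> {for x, continuous u}.

(* To be used with A open. *)
Definition C2_on n (A : set 'rV[R]_n) (u : 'rV[R]_n -> R) : Prop :=
  [/\ continuous_on A u,
      forall i, (forall x, A x -> derivable u x (delta_mx ord0 i)) /\
        continuous_on A (pderive i u) &
      forall i j,
        (forall x, A x -> derivable (pderive i u) x (delta_mx ord0 j)) /\
        continuous_on A (pderive j (pderive i u))].

Definition laplacian n (u : 'rV[R]_n -> R) (x : 'rV[R]_n) : R :=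
  \sum_i pderive i (pderive i u) x.

End euclidean.

Section special_functions.
Context {R : realType}.

Definition Gamma_fun (s : R) : R :=
  \int[lebesgue_measure]_(t in `]0, +oo[) (t `^ (s - 1) * expR (- t)).

(* The coefficient of z ^ m in the Taylor expansion at z = 0 of the generating
   function (1 - 2 t z + z ^ 2) ^ (- lambda). *)
Definition gegenbauer (m : nat) (lambda t : R) : R :=
  derive1n m (fun z : R => (1 - 2 * t * z + z ^+ 2) `^ (- lambda)) 0 / m`!%:R.

Definition omega_ball (n : nat) : R :=
  pi `^ (n%:R / 2) / Gamma_fun (1 + n%:R / 2).

Definition alpha_const (n : nat) : R := 2 / (n%:R * omega_ball n).

End special_functions.

(* The ambient space R^n is 'rV[R]_d.+1, with n = d.+1, and the boundary
   hyperplane R^(n-1) is 'rV[R]_d; the last coordinate is x_n. *)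
Section half_space.
Context {R : realType} {d : nat}.
Implicit Types (x : 'rV[R]_d.+1) (y : 'rV[R]_d) (f : 'rV[R]_d -> R).

Definition xlast x : R := x ord0 ord_max.

Definition bproj x : 'rV[R]_d := \row_i x ord0 (widen_ord (leqnSn d) i).

Definition half_space : set 'rV[R]_d.+1 := [set x | 0 < xlast x].

(* The angle theta between x and the normal e_n. *)
Definition polar_angle x : R := vangle x (delta_mx ord0 ord_max).

Definition kernelK (lambda : R) x y : R :=
  (enorm (y - bproj x) ^+ 2 + xlast x ^+ 2) `^ (- lambda).

Definition kernelKM (M : nat) (lambda : R) x y : R :=
  kernelK lambda x y -
  \sum_(m < M) enorm x ^+ m / enorm y `^ (m%:R + 2 * lambda) *
    gegenbauer m lambda (sin (polar_angle x) * cos (vangle (bproj x) y)).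

Definition D_integral f x : R :=
  alpha_const d.+1 * xlast x *
  \int[lebesgue_row d]_y (f y * kernelK (d.+1%:R / 2) x y).

Definition DM_integral (M : nat) f x : R :=
  alpha_const d.+1 * xlast x *
  \int[lebesgue_row d]_y (f y * kernelKM M (d.+1%:R / 2) x y).

(* The supremum is taken in the extended reals, so that it is +oo when the
   quotient is unbounded on a half sphere. *)
Definition little_o_half_space (g omega : 'rV[R]_d.+1 -> R) : Prop :=
  ereal_sup [set (`|g x| / omega x)%:E |
             x in half_space `&` [set x | enorm x = r]]
    @[r --> +oo%R] --> 0%E.

End half_space.

(* Main.v *)
Require Import Defs.
From HB Require Import structures.
From mathcomp Require Import all_boot all_order all_algebra.
From mathcomp Require Import all_classical all_reals all_analysis.
From mathcomp Require Import measurable_realfun.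
From mathcomp Require Import ring lra zify.

(**
Write n = d + 1, let x' = bproj x, and let Q(x, y) = |y|^2 - 2 <x', y> + |x|^2 be
the squared distance from x to the boundary point y.

The sum subtracted from K = Q^(-n/2) is the Taylor polynomial T_M at s = 0 of
s |-> Q(s x, y)^(-n/2), evaluated at s = 1: its k-th term is the k-th Taylor
coefficient of (q + l h + b h^2)^(-n/2) for (q, l, b) = (|y|^2, -2 <x', y>, |x|^2).
These coefficients ([tcoef]) satisfy a recursion which trades one index for a
larger exponent, and every algebraic and analytic fact about them is an induction
along it; Gegenbauer polynomials only appear when the statement is translated
([gegenbauer_tcoef], [kernelKM_tpoly]).

The cut-off function only serves to remove the singularity of T_M at y = 0: the
two integrals add up to the single integral of f G_M with G_M = K - w T_M
([mkernel], [poisson_extensionE]). With G_M^N the same kernel for the exponent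
-N/2, three facts carry the proof.

- Closure under differentiation ([is_derive_mkernel]):
  D_v G_M^N = -N (<x, v> G_(M-2)^(N+2) - <v', y> G_(M-1)^(N+2)), where negative
  indices are read as 0.
- Decay ([mkernel_bound]): |G_M^N| <= C / (|y|^(M+N) + 1), locally uniformly in x.
  For |y| >= 2 |x| this is the Taylor remainder estimate.
- The three-term relation ([mkernel_mul]), that is Q Q^(-N/2-1) = Q^(-N/2) for the
  Taylor remainders:
  |y|^2 G_M^(N+2) - 2 <x', y> G_(M-1)^(N+2) + |x|^2 G_(M-2)^(N+2) = G_M^N.

By the first two, integrals of f G_M^N can be differentiated under the integral
sign as often as one likes and stay in the algebra that such integrals generate
([is_derive_kint], [kernel_class_C2]). The third one makes the Laplacian of
x_n * (integral of f G_M^n) collapse to 0 ([kint_harmonic]).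

For the boundary values, alpha_n x_n K has total mass one ([poisson_mass]). Hence
u(x) - f(y0) is alpha_n x_n times the integral of f G_M - f(y0) K. Near y0 the
integrand is small compared with K up to a bounded error, elsewhere it is dominated
by a fixed integrable function, and the factor x_n tends to 0 ([poisson_limit]).

For the growth, write sec = |x| / x_n for the secant of the polar angle. For
|x| >= 1, |x_n G_M| / (|x|^(M+1) sec^d) is at most C / (|y|^(M+n) + 1) and also at most
C / |x| ([growth_bound_decay], [growth_bound_flat]); dominated convergence gives
the o(1) ([poisson_growth]).
*)

Set Implicit Arguments.
Unset Strict Implicit.
Unset Printing Implicit Defensive.

Import Order.TTheory GRing.Theory Num.Theory.
Import numFieldNormedType.Exports.

Local Open Scope classical_set_scope.
Local Open Scope ring_scope.

(** * Taylor coefficients of powers of a quadratic polynomial *)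

Section real_valued_derivatives.
Context {R : realType} {V : normedModType R}.
Implicit Types (f g : V -> R) (x v : V).

Lemma is_derive_ext f g x v (df dg : R) :
  is_derive x v f df -> f =1 g -> df = dg -> is_derive x v g dg.
Proof. by move=> hf /funext <- <-. Qed.

Lemma is_derive_add f g x v (df dg : R) : is_derive x v f df ->
  is_derive x v g dg -> is_derive x v (fun t => f t + g t) (df + dg).
Proof. by move=> hf hg; exact: is_deriveD. Qed.

Lemma is_derive_sub f g x v (df dg : R) : is_derive x v f df ->
  is_derive x v g dg -> is_derive x v (fun t => f t - g t) (df - dg).
Proof. by move=> hf hg; exact: is_deriveB. Qed.

Lemma is_derive_mul f g x v (df dg : R) : is_derive x v f df ->
  is_derive x v g dg ->
  is_derive x v (fun t => f t * g t) (df * g x + f x * dg).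
Proof.
move=> hf hg; apply: is_derive_eq (is_deriveM hf hg) _.
by rewrite addrC mulrC.
Qed.

Lemma is_derive_cmul f x v (c df : R) : is_derive x v f df ->
  is_derive x v (fun t => c * f t) (c * df).
Proof. by move=> hf; exact: is_deriveZ. Qed.

Lemma is_derive_bigsum I (r : seq I) (h : I -> V -> R) (dh : I -> R) x v :
  (forall i, is_derive x v (h i) (dh i)) ->
  is_derive x v (fun t => \sum_(i <- r) h i t) (\sum_(i <- r) dh i).
Proof.
move=> dhi; elim: r => [|i r IH].
  by under eq_fun do rewrite big_nil; rewrite big_nil; exact: is_derive_cst.
under eq_fun do rewrite big_cons; rewrite big_cons.
exact: is_derive_add.
Qed.

End real_valued_derivatives.

(** The power q^(-N/2); an integer N suffices, and spares real exponents. *)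
Definition sqrtVX (R : realType) (N : nat) (q : R) : R := Num.sqrt q ^- N.

(** For k >= 1 this is the Taylor coefficient of h^(k-1) at h = 0 of
    (q + l h + b h^2)^(-N/2). Differentiating in h gives the recursion, which lowers
    the index and raises N by 2. The shift of the index by one makes the value 0 at
    k = 0 the right one for the terms of negative index, so that identities
    involving k.-1 and k.-2 hold for every k. *)
Fixpoint tcoef_fix (R : realType) (k N : nat) (q l b : R) : R :=
  if k is k'.+1 then
    if k' is k''.+1 then
      - (N%:R / 2) / k'%:R *
        (l * tcoef_fix k' N.+2 q l b + 2 * b * tcoef_fix k'' N.+2 q l b)
    else sqrtVX N q
  else 0.

HB.lock Definition tcoef := tcoef_fix.

Section taylor_coefficients.
Context {R : realType}.
Implicit Types (q l b : R) (N k : nat).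

Lemma tcoef0 N q l b : tcoef 0 N q l b = 0. Proof. by rewrite unlock. Qed.

Lemma tcoef1 N q l b : tcoef 1 N q l b = sqrtVX N q.
Proof. by rewrite unlock. Qed.

Lemma tcoefSS k N q l b : tcoef k.+2 N q l b =
  - (N%:R / 2) / k.+1%:R *
    (l * tcoef k.+1 N.+2 q l b + 2 * b * tcoef k N.+2 q l b).
Proof. by rewrite unlock. Qed.

Lemma sqrtVX_ge0 N q : 0 <= sqrtVX N q.
Proof. by rewrite invr_ge0 exprn_ge0. Qed.

Lemma sqrtVXD2 N q : 0 < q -> q * sqrtVX N.+2 q = sqrtVX N q.
Proof.
move=> q0; rewrite /sqrtVX -addn2 exprD sqr_sqrtr ?ltW// invfM mulrC.
by rewrite divfK// gt_eqF.
Qed.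

Lemma sqrtVX_powR N q : 0 <= q -> q `^ (- (N%:R / 2)) = sqrtVX N q.
Proof.
move=> q0; rewrite powRN /sqrtVX mulrC powRrM powR12_sqrt//.
by rewrite powR_mulrn.
Qed.

(** The coefficient of h^(k-2) in the derivative of (q + l h + b h^2)^(-N/2). *)
Lemma tcoef_rec k N q l b : (k%:R - 1) * tcoef k N q l b =
  - (N%:R / 2) * (l * tcoef k.-1 N.+2 q l b + 2 * b * tcoef k.-2 N.+2 q l b).
Proof.
case: k => [|[|k]]; rewrite ?tcoef0 ?tcoef1 ?(mulr0, addr0, subrr, mul0r)//.
have -> : k.+2%:R - 1 = k.+1%:R :> R by rewrite -[X in _ - X]/1%:R -natrB// subn1.
by rewrite tcoefSS; field.
Qed.

Lemma nat_ind2 (P : nat -> Prop) : P 0%N -> P 1%N ->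
  (forall k, P k -> P k.+1 -> P k.+2) -> forall k, P k.
Proof.
move=> P0 P1 PS k; suff [] : P k /\ P k.+1 by [].
by elim: k => // k [Pk PSk]; split => //; exact: PS.
Qed.

(** The coefficient of h^(k-1) in P * P^(-N/2-1) = P^(-N/2), where
    P = q + l h + b h^2. *)
Lemma tcoef_mul k N q l b : 0 < q ->
  q * tcoef k N.+2 q l b + l * tcoef k.-1 N.+2 q l b
    + b * tcoef k.-2 N.+2 q l b = tcoef k N q l b.
Proof.
move=> q0; move: k N; elim/nat_ind2 => [N|N|k IH1 IH2 N].
- by rewrite !tcoef0 !mulr0 !addr0.
- by rewrite !tcoef0 !tcoef1 !mulr0 !addr0 sqrtVXD2.
apply: (@mulfI _ k.+1%:R); first by rewrite pnatr_eq0.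
have e2 := tcoef_rec k.+2 N.+2 q l b.
have e1 := tcoef_rec k.+1 N.+2 q l b.
have e0 := tcoef_rec k N.+2 q l b.
have e := tcoef_rec k.+2 N q l b.
have := IH1 N.+2; have := IH2 N.+2; move: e2 e1 e0 e.
have -> : k.+2%:R = k%:R + 2 :> R by rewrite -addn2 natrD.
have -> : k.+1%:R = k%:R + 1 :> R by rewrite -addn1 natrD.
have -> : N.+2%:R = N%:R + 2 :> R by rewrite -addn2 natrD.
rewrite /= => e2 e1 e0 e f2 f1.
rewrite [RHS](_ : _ = (k%:R + 2 - 1) * tcoef k.+2 N q l b); last by ring.
rewrite e [LHS](_ : _ = q * ((k%:R + 2 - 1) * tcoef k.+2 N.+2 q l b)
  + l * ((k%:R + 1 - 1) * tcoef k.+1 N.+2 q l b)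
  + b * ((k%:R - 1) * tcoef k N.+2 q l b)
  + l * tcoef k.+1 N.+2 q l b + 2 * b * tcoef k N.+2 q l b); last by ring.
by rewrite e2 e1 e0 -f2 -f1; field.
Qed.

Lemma is_derive_sqrtVX N q : 0 < q ->
  is_derive q 1 (sqrtVX N) (- (N%:R / 2) * sqrtVX N.+2 q).
Proof.
move=> q0; have sq0 : 0 < Num.sqrt q by rewrite sqrtr_gt0.
have qn0 : Num.sqrt q ^+ N != 0 by rewrite expf_neq0// gt_eqF.
have XE : (fun q : R => Num.sqrt q ^+ N) = Num.sqrt ^+ N.
  by apply/funext => t; rewrite exprfctE.
have dX := is_deriveX N (is_derive1_sqrt q0); rewrite -XE in dX.
have [dX1 dX2] := dX; apply: DeriveDef; first exact: derivableV.
rewrite deriveV// dX2.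
rewrite /sqrtVX /GRing.scale/=.
case: N qn0 {XE dX dX1 dX2} => [|N] qn0; first by rewrite !mul0r oppr0 mul0r mulr0.
by rewrite !exprS /=; field; rewrite expf_neq0 gt_eqF.
Qed.

(** The chain rule. As D (P^(-N/2)) = -(N/2) (dq + dl h + db h^2) P^(-N/2-1), a
    change of q, l or b only shifts the index by 0, 1 or 2. *)
Lemma is_derive_tcoef k N (q l b : R -> R) (dq dl db s : R) :
  0 < q s -> is_derive s 1 q dq -> is_derive s 1 l dl -> is_derive s 1 b db ->
  is_derive s 1 (fun t => tcoef k N (q t) (l t) (b t))
    (- (N%:R / 2) * (dq * tcoef k N.+2 (q s) (l s) (b s)
      + dl * tcoef k.-1 N.+2 (q s) (l s) (b s)
      + db * tcoef k.-2 N.+2 (q s) (l s) (b s))).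
Proof.
move=> q0 hq hl hb; move: k N; elim/nat_ind2 => [N|N|k IH1 IH2 N].
- under eq_fun do rewrite tcoef0; rewrite !tcoef0 !(mulr0, addr0).
  exact: is_derive_cst.
- under eq_fun do rewrite tcoef1; rewrite !tcoef0 !tcoef1 !(mulr0, addr0).
  have := @is_derive1_comp _ (sqrtVX N) q s _ _ (is_derive_sqrtVX N q0) hq.
  by rewrite mulrCA mulrC.
have d1 := IH2 N.+2; have d2 := IH1 N.+2.
apply: (is_derive_ext (is_derive_cmul (- (N%:R / 2) / k.+1%:R)
  (is_derive_add (is_derive_mul hl d1)
    (is_derive_cmul 2 (is_derive_mul hb d2))))).
  by move=> t; rewrite tcoefSS; ring.
have e2 := tcoef_rec k.+2 N.+2 (q s) (l s) (b s).
have e1 := tcoef_rec k.+1 N.+2 (q s) (l s) (b s).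
have e0 := tcoef_rec k N.+2 (q s) (l s) (b s).
move: e2 e1 e0; rewrite /=.
set A := tcoef k.+2 N.+2 _ _ _; set B := tcoef k.+1 N.+2 _ _ _.
set C := tcoef k N.+2 _ _ _.
have -> : k.+2%:R = k%:R + 2 :> R by rewrite -addn2 natrD.
have -> : k.+1%:R = k%:R + 1 :> R by rewrite -addn1 natrD.
have k0 : k%:R + 1 != 0 :> R by rewrite -[1]/(1%:R) -natrD addn1 pnatr_eq0.
move=> e2 e1 e0; apply: (@mulfI _ (k%:R + 1)) => //.
transitivity (- (N%:R / 2) * (dq * ((k%:R + 2 - 1) * A)
  + dl * ((k%:R + 1 - 1) * B + B) + db * ((k%:R - 1) * C + 2 * C))); last by ring.
by rewrite e2 e1 e0; field.
Qed.

(** The hypotheses are scale invariant: kap has the dimension of 1/h. In the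
    recursion l comes with an index lower by one and b with an index lower by two,
    and q sqrtVX N.+2 q = sqrtVX N q absorbs the factor q. *)
Lemma tcoef_bound k N : exists2 C : R, 0 <= C & forall kap q l b : R,
  0 < q -> 0 <= kap -> `|l| <= kap * q -> `|b| <= kap ^+ 2 * q ->
  `|tcoef k.+1 N q l b| <= C * kap ^+ k * sqrtVX N q.
Proof.
move: k N; elim/nat_ind2 => [N|N|k IH1 IH2 N].
- exists 1 => // kap q l b q0 _ _ _.
  by rewrite tcoef1 expr0 !mul1r ger0_norm// sqrtVX_ge0.
- exists (N%:R / 2); first by rewrite divr_ge0.
  move=> kap q l b q0 kap0 lkap bkap.
  rewrite tcoefSS tcoef0 tcoef1 mulr0 addr0 divr1 expr1 normrM normrN.
  rewrite [`|N%:R / 2|]ger0_norm ?divr_ge0//.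
  rewrite -[X in _ <= X]mulrA ler_wpM2l ?divr_ge0//.
  rewrite normrM (ger0_norm (sqrtVX_ge0 _ _)) -(sqrtVXD2 N q0) mulrA.
  by rewrite ler_wpM2r// sqrtVX_ge0.
have [C1 C10 H1] := IH1 N.+2; have [C2 C20 H2] := IH2 N.+2.
exists (N%:R / 2 / k.+2%:R * (C2 + 2 * C1)).
  by rewrite mulr_ge0 ?divr_ge0// addr_ge0// mulr_ge0.
move=> kap q l b q0 kap0 lkap bkap; rewrite tcoefSS normrM.
rewrite normrM normrN normfV [`|N%:R / 2|]ger0_norm ?divr_ge0//.
rewrite [`|k.+2%:R|]ger0_norm// -2![leRHS]mulrA.
rewrite ler_wpM2l ?divr_ge0// (le_trans (ler_normD _ _))// !normrM.
rewrite (ger0_norm (ler0n _ 2)) -(sqrtVXD2 N q0).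
rewrite [leRHS](_ : _ =
  (kap * q) * (C2 * kap ^+ k.+1 * sqrtVX N.+2 q)
  + 2 * (kap ^+ 2 * q) * (C1 * kap ^+ k * sqrtVX N.+2 q)); last first.
  by rewrite !exprS expr0; ring.
apply: lerD; first by apply: ler_pM => //; exact: H2.
by apply: ler_pM => //; [rewrite ler_wpM2l|exact: H1].
Qed.

(** Substituting h := (a / c) h in c^2 (q + l h + b h^2). *)
Lemma tcoef_scale k N a c q l b : 0 < c -> 0 <= q ->
  tcoef k.+1 N (c ^+ 2 * q) (c * a * l) (a ^+ 2 * b) =
  a ^+ k / c ^+ (k + N) * tcoef k.+1 N q l b.
Proof.
move=> c0 q0; have cn0 : c != 0 by rewrite gt_eqF.
have sE N' : sqrtVX N' (c ^+ 2 * q) = c ^- N' * sqrtVX N' q.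
  rewrite /sqrtVX sqrtrM ?sqr_ge0// sqrtr_sqr gtr0_norm// exprMn invfM.
  by [].
move: k N; elim/nat_ind2 => [N|N|k IH1 IH2 N].
- by rewrite !tcoef1 sE expr0 mul1r add0n.
- rewrite !tcoefSS !tcoef0 !tcoef1 sE !mulr0 !addr0 add1n expr1 !exprS.
  by field; rewrite expf_neq0.
rewrite !(tcoefSS k.+1) IH1 IH2 !addSn !addnS !exprS.
by field; rewrite expf_neq0// cn0 -natrD pnatr_eq0.
Qed.

(** Here g k is the k-th Taylor coefficient of g 0 at the moving point s. The sum of
    the g k s (1 - s)^k over k < M telescopes upon differentiation to
    M g M s (1 - s)^(M-1), so one application of the mean value theorem bounds the
    remainder. *)
Lemma taylor_bound (g : nat -> R -> R) (M : nat) (B : R) :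
  (forall k (s : R), 0 <= s <= 1 -> is_derive s 1 (g k) (k.+1%:R * g k.+1 s)) ->
  (forall s : R, 0 <= s <= 1 -> `|g M s| <= B) ->
  `|g 0%N 1 - \sum_(k < M) g k 0| <= M.+1%:R * B.
Proof.
move=> dg gB.
have B0 : 0 <= B by rewrite (le_trans _ (gB 0 _)) ?lexx ?ler01.
case: M gB => [|M] gB.
  by rewrite big_ord0 subr0 mul1r gB// ler01 lexx.
pose h m s : R := \sum_(k < m) g k s * (1 - s) ^+ k.
have dX m (s : R) : is_derive s 1 (fun t : R => (1 - t) ^+ m)
    (- (m%:R * (1 - s) ^+ m.-1)).
  have d1 : is_derive s 1 (fun t : R => 1 - t) (- 1).
    rewrite -[- 1]add0r; apply: is_derive_sub.
  apply: (is_derive_ext (is_deriveX m d1)) => //.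
    by move=> t; rewrite exprfctE.
  exact: mulrN1.
have dh m (s : R) : 0 <= s <= 1 ->
    is_derive s 1 (h m) (m%:R * g m s * (1 - s) ^+ m.-1).
  move=> s01; elim: m => [|m IH].
    rewrite !mul0r /h; under eq_fun do rewrite big_ord0.
    exact: is_derive_cst.
  apply: (is_derive_ext (is_derive_add IH (is_derive_mul (dg m s s01) (dX m s)))).
    by move=> t; rewrite /h big_ord_recr.
  by rewrite /=; case: m {IH} => [|m] /=; rewrite -?natr1; ring.
have [|||c c01] := @MVT_segment _ (h M.+1)
  (fun s => M.+1%:R * g M.+1 s * (1 - s) ^+ M) 0 1.
- exact: ler01.
- by move=> s /andP[s0 s1]; apply: (dh M.+1); rewrite !ltW.
- apply: derivable_within_continuous => s s01.
  by have [] := dh M.+1 s s01.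
have -> : h M.+1 0 = \sum_(k < M.+1) g k 0.
  by apply: eq_bigr => k _; rewrite subr0 expr1n mulr1.
have -> : h M.+1 1 = g 0%N 1.
  rewrite /h big_ord_recl expr0 mulr1 big1 ?addr0// => k _.
  by rewrite subrr expr0n mulr0.
move=> ->; rewrite subr0 mulr1 !normrM ger0_norm//.
have /andP[c0 c1] : 0 <= c <= 1 by [].
have -> : M.+2%:R * B = M.+1%:R * B * 1 + B by rewrite -natr1; ring.
rewrite -[leLHS]addr0 lerD// ler_pM// ?mulr_ge0//.
  by rewrite ler_wpM2l// gB// c0.
by rewrite normrX exprn_ile1// ger0_norm; lra.
Qed.


(** Moving the base point of the expansion of one fixed quadratic polynomial turns
    the k-th coefficient into k + 1 times the next one. *)
Lemma is_derive_tcoef_quad k N (q l b s : R) : 0 < q + l * s + b * s ^+ 2 ->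
  is_derive s 1
    (fun t : R => tcoef k.+1 N (q + l * t + b * t ^+ 2) (l + 2 * b * t) b)
    (k.+1%:R * tcoef k.+2 N (q + l * s + b * s ^+ 2) (l + 2 * b * s) b).
Proof.
move=> q0; have did : is_derive s 1 (fun t : R => t) 1 by exact: is_derive_id.
have dc (c : R) : is_derive s 1 (fun t : R => c) 0 by exact: is_derive_cst.
have dl : is_derive s 1 (fun t => l + 2 * b * t) (0 + 2 * b * 1).
  by apply: is_derive_add => //; exact: is_derive_cmul.
have dq : is_derive s 1 (fun t => q + l * t + b * t ^+ 2) (l + 2 * b * s).
  apply: (is_derive_ext (is_derive_add (is_derive_add (dc q)
    (is_derive_cmul l did)) (is_derive_cmul b (is_derive_mul did did)))).
    by move=> t; rewrite expr2.
  by ring.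
have H := @is_derive_tcoef k.+1 N (fun t => q + l * t + b * t ^+ 2) _ _ _ _ _ _
  q0 dq dl (dc b).
apply: (is_derive_ext H) => //.
transitivity ((k.+2%:R - 1) *
    tcoef k.+2 N (q + l * s + b * s ^+ 2) (l + 2 * b * s) b).
  by rewrite tcoef_rec /=; ring.
by rewrite -[k.+2]addn1 natrD addrK.
Qed.

(** All derivatives of the generating function are identified at once on |z| < 1,
    where 1 - 2 t z + z^2 >= (1 - |z|)^2 is positive. *)
Lemma gegenbauer_tcoef m N (t : R) : `|t| <= 1 ->
  gegenbauer m (N%:R / 2) t = tcoef m.+1 N 1 (- 2 * t) 1.
Proof.
move=> t1; pose Q (z : R) : R := 1 + - 2 * t * z + 1 * z ^+ 2.
have Q0 (z : R) : `|z| < 1 -> 0 < Q z.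
  move=> z1; have : t * z <= `|z|.
    by rewrite (le_trans (ler_norm _))// normrM ler_piMl.
  have : z ^+ 2 = `|z| ^+ 2 by rewrite real_normK// num_real.
  by rewrite /Q; nra.
pose f (z : R) : R := (1 - 2 * t * z + z ^+ 2) `^ (- (N%:R / 2)).
suff main (z : R) : `|z| < 1 ->
    derive1n m f z = m`!%:R * tcoef m.+1 N (Q z) (- 2 * t + 2 * 1 * z) 1.
  rewrite /gegenbauer main ?normr0// mulrC mulKf ?pnatr_eq0 -?lt0n ?fact_gt0//.
  by rewrite /Q !mulr0 expr0n mulr0 !addr0.
elim: m z => [|m IH] z z1.
  rewrite mul1r tcoef1 -sqrtVX_powR ?ltW ?Q0//.
  by rewrite derive1n0 /f /Q mul1r mulNr mulNr.
rewrite derive1nS derive1E.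
pose g (z : R) := m`!%:R * tcoef m.+1 N (Q z) (- 2 * t + 2 * 1 * z) 1.
have -> : 'D_1 (derive1n m f) z = 'D_1 g z.
  apply: near_eq_derive.
  near=> y; apply: IH; near: y.
  exact: (cvgr_norm_lt (f := id) z).
have := is_derive_cmul m`!%:R (@is_derive_tcoef_quad m N 1 (- 2 * t) 1 z (Q0 z z1)).
by case=> _ e; rewrite [LHS]e factS natrM /Q; ring.
Unshelve. all: by end_near. Qed.

End taylor_coefficients.

(** * Euclidean geometry of row vectors *)

Section euclidean_facts.
Context {R : realType}.
Implicit Types (n : nat).

Lemma edotC n (u v : 'rV[R]_n) : edot u v = edot v u.
Proof. by apply: eq_bigr => i _; rewrite mulrC. Qed.

Lemma edotDl n (u v t : 'rV[R]_n) : edot (u + v) t = edot u t + edot v t.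
Proof.
by rewrite /edot -big_split; apply: eq_bigr => i _; rewrite mxE mulrDl.
Qed.

Lemma edotZl n (a : R) (u v : 'rV[R]_n) : edot (a *: u) v = a * edot u v.
Proof.
by rewrite /edot mulr_sumr; apply: eq_bigr => i _; rewrite mxE mulrA.
Qed.

Lemma edotDr n (u v t : 'rV[R]_n) : edot u (v + t) = edot u v + edot u t.
Proof. by rewrite edotC edotDl !(edotC u). Qed.

Lemma edotZr n (a : R) (u v : 'rV[R]_n) : edot u (a *: v) = a * edot u v.
Proof. by rewrite edotC edotZl edotC. Qed.

Lemma edotBr n (u v t : 'rV[R]_n) : edot u (v - t) = edot u v - edot u t.
Proof. by rewrite edotDr -scaleN1r edotZr mulN1r. Qed.

Lemma edotBl n (u v t : 'rV[R]_n) : edot (u - v) t = edot u t - edot v t.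
Proof. by rewrite edotC edotBr !(edotC t). Qed.

Lemma edot0l n (u : 'rV[R]_n) : edot 0 u = 0.
Proof. by rewrite -(scale0r 0) edotZl mul0r. Qed.

Lemma edot_ge0 n (u : 'rV[R]_n) : 0 <= edot u u.
Proof. by apply: sumr_ge0 => i _; rewrite -expr2 sqr_ge0. Qed.

Lemma enorm_ge0 n (u : 'rV[R]_n) : 0 <= enorm u.
Proof. exact: sqrtr_ge0. Qed.

Lemma enorm_sqr n (u : 'rV[R]_n) : enorm u ^+ 2 = edot u u.
Proof. by rewrite sqr_sqrtr// edot_ge0. Qed.

Lemma enorm_eq0 n (u : 'rV[R]_n) : (enorm u == 0) = (u == 0).
Proof.
apply/idP/eqP => [u0|->]; last by rewrite /enorm edot0l sqrtr0.
have : edot u u == 0 by rewrite -enorm_sqr (eqP u0) expr0n.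
rewrite psumr_eq0 => [/allP u00|i _]; last by rewrite -expr2 sqr_ge0.
apply/rowP => i; rewrite mxE; apply/eqP; rewrite -sqrf_eq0 expr2.
by apply: u00; rewrite mem_index_enum.
Qed.

Lemma enorm_gt0 n (u : 'rV[R]_n) : (0 < enorm u) = (u != 0).
Proof. by rewrite lt_def enorm_eq0 enorm_ge0 andbT. Qed.

(** Cauchy-Schwarz, from the square of the component of u orthogonal to v. *)
Lemma edot_enorm n (u v : 'rV[R]_n) : `|edot u v| <= enorm u * enorm v.
Proof.
have [->|v0] := eqVneq v 0.
  by rewrite edotC edot0l normr0 mulr_ge0// enorm_ge0.
have vv0 : 0 < edot v v by rewrite -enorm_sqr exprn_gt0// enorm_gt0.
rewrite -ler_sqr ?nnegrE ?mulr_ge0 ?enorm_ge0// real_normK ?num_real//.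
rewrite exprMn !enorm_sqr.
have := edot_ge0 (u - (edot u v / edot v v) *: v).
rewrite edotBl !edotBr !edotZl !edotZr (edotC v u).
rewrite (_ : _ - _ = edot u u - edot u v ^+ 2 / edot v v); last first.
  by field; rewrite gt_eqF.
by rewrite subr_ge0 ler_pdivrMr.
Qed.

Lemma enormD n (u v : 'rV[R]_n) : enorm (u + v) <= enorm u + enorm v.
Proof.
rewrite -ler_sqr ?nnegrE ?addr_ge0 ?enorm_ge0// sqrrD !enorm_sqr.
rewrite edotDl !edotDr (edotC v u) -mulr_natl.
by have := le_trans (ler_norm _) (edot_enorm u v); lra.
Qed.

Lemma enormZ n (a : R) (u : 'rV[R]_n) : enorm (a *: u) = `|a| * enorm u.
Proof.
by rewrite /enorm edotZl edotZr mulrA -expr2 sqrtrM ?sqr_ge0// sqrtr_sqr.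
Qed.

Lemma coord_enorm n (u : 'rV[R]_n) i : `|u ord0 i| <= enorm u.
Proof.
rewrite -ler_sqr ?nnegrE ?enorm_ge0// enorm_sqr real_normK ?num_real//.
rewrite /edot (bigD1 i)//= -expr2 lerDl sumr_ge0// => j _.
by rewrite -expr2 sqr_ge0.
Qed.

Lemma coord_continuous_row n i : continuous (fun u : 'rV[R]_n => u ord0 i).
Proof. exact: coord_continuous. Qed.

Lemma continuous_mul (T : topologicalType) (f g : T -> R) :
  continuous f -> continuous g -> continuous (fun u => f u * g u).
Proof. by move=> cf cg u; apply: continuousM; [exact: cf|exact: cg]. Qed.

Lemma continuous_add (T : topologicalType) (f g : T -> R) :
  continuous f -> continuous g -> continuous (fun u => f u + g u).
Proof. by move=> cf cg u; apply: continuousD; [exact: cf|exact: cg]. Qed.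

Lemma edot_continuous n : continuous (fun u : 'rV[R]_n => edot u u).
Proof.
rewrite /edot; elim: (index_enum _) => [|i r IH].
  by under eq_fun do rewrite big_nil; exact: cst_continuous.
under eq_fun do rewrite big_cons.
apply: (@continuous_add 'rV[R]_n) => //.
by apply: (@continuous_mul 'rV[R]_n); exact: coord_continuous_row.
Qed.

Lemma enorm_continuous n : continuous (@enorm R n).
Proof.
move=> u; rewrite /enorm; apply: continuous_comp; first exact: edot_continuous.
exact: sqrt_continuous.
Qed.

Lemma edot_bproj d (x v : 'rV[R]_d.+1) :
  edot x v = edot (bproj x) (bproj v) + xlast x * xlast v.
Proof.
rewrite /edot big_ord_recr /=; congr (_ + _).
by apply: eq_bigr => i _; rewrite !mxE.
Qed.

Lemma bprojD d (x v : 'rV[R]_d.+1) : bproj (x + v) = bproj x + bproj v.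
Proof. by apply/rowP => i; rewrite !mxE. Qed.

Lemma bprojZ d a (x : 'rV[R]_d.+1) : bproj (a *: x) = a *: bproj x.
Proof. by apply/rowP => i; rewrite !mxE. Qed.

Lemma enorm_bproj d (x : 'rV[R]_d.+1) : enorm (bproj x) <= enorm x.
Proof.
by apply: ler_wsqrtr; rewrite [X in _ <= X]edot_bproj lerDl -expr2 sqr_ge0.
Qed.

End euclidean_facts.

(** * The modified kernel and its derivatives *)

Section directional.
Context {R : realType} {V : normedModType R}.

(** Both sides have the same difference quotient; this reduces directional
    derivatives to derivatives on the real line. *)
Lemma is_derive_lineE (F : V -> R) (x v : V) (t df : R) :
  is_derive t 1 (fun s : R => F (s *: v + x)) df <->
  is_derive (t *: v + x) v F df.
Proof.
pose G (h : R) := h^-1 *: ((F \o shift (t *: v + x)) (h *: v) - F (t *: v + x)).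
pose H (h : R) := h^-1 *:
  (((fun s : R => F (s *: v + x)) \o shift t) (h *: (1 : R)) - F (t *: v + x)).
have E : H = G.
  apply/funext => h; rewrite /H /G /=.
  rewrite [X in F (X *: _ + _)](_ : _ = h + t); last by congr (_ + _); exact: mulr1.
  by rewrite scalerDl addrA.
split => -[d1 d2]; apply: DeriveDef.
- by move: d1; rewrite /derivable -/H E.
- by move: d2; rewrite /derive -/H E.
- by move: d1; rewrite /derivable -/G -E.
- by move: d2; rewrite /derive -/G -E.
Qed.

Lemma is_derive_line (F : V -> R) (x v : V) (df : R) :
  is_derive (0 : R) 1 (fun t : R => F (t *: v + x)) df -> is_derive x v F df.
Proof. by move=> /is_derive_lineE; rewrite scale0r add0r. Qed.

End directional.

Section kernel.
Context {R : realType} {d : nat}.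
Implicit Types (x v : 'rV[R]_d.+1) (y : 'rV[R]_d) (k M N : nat).

Definition sqdist x y : R := edot y y + - 2 * edot (bproj x) y + edot x x.

(** For k >= 1, the part of K that is homogeneous of degree k - 1 in x:
    |x|^(k-1) |y|^(1-k-N) times a Gegenbauer polynomial of the cosine of the angle
    between x and y. *)
Definition hterm k N x y : R :=
  tcoef k N (edot y y) (- 2 * edot (bproj x) y) (edot x x).

(** The Taylor polynomial T_M of degree M - 1 of K(., y) at x = 0. *)
Definition tpoly M N x y : R := \sum_(k < M) hterm k.+1 N x y.

(** The kernel G_M = K - w T_M, which integrates f directly: as w vanishes near
    y = 0, it has none of the singularities of T_M, and for |y| >= 2 it is the
    modified kernel. *)
Definition mkernel (w : 'rV[R]_d -> R) M N x y : R :=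
  sqrtVX N (sqdist x y) - w y * tpoly M N x y.

Lemma sqdistE x y :
  sqdist x y = enorm (y - bproj x) ^+ 2 + xlast x ^+ 2.
Proof.
rewrite enorm_sqr /sqdist (edot_bproj x x) edotBl !edotBr (edotC y).
by ring.
Qed.

Lemma sqdist_ge_xlast x y : xlast x ^+ 2 <= sqdist x y.
Proof. by rewrite sqdistE lerDr sqr_ge0. Qed.

Lemma sqdist_half_space x y : half_space x -> 0 < sqdist x y.
Proof.
by move=> x0; apply: lt_le_trans (sqdist_ge_xlast x y); rewrite exprn_gt0.
Qed.

(** Truncated predecessors are harmless because hterm 0 = 0. *)
Lemma tpoly_pred M N x y :
  \sum_(k < M) hterm k N x y = tpoly M.-1 N x y.
Proof.
case: M => [|M]; first by rewrite /tpoly !big_ord0.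
by rewrite big_ord_recl /hterm tcoef0 add0r.
Qed.

Lemma tpoly_pred2 M N x y :
  \sum_(k < M) hterm k.-1 N x y = tpoly M.-2 N x y.
Proof.
case: M => [|M]; first by rewrite /tpoly !big_ord0.
rewrite big_ord_recl [X in X + _](_ : _ = 0) ?add0r ?tpoly_pred//.
by rewrite /hterm tcoef0.
Qed.

Lemma tpoly_mul M N x y : 0 < edot y y ->
  edot y y * tpoly M N.+2 x y - 2 * edot (bproj x) y * tpoly M.-1 N.+2 x y
    + edot x x * tpoly M.-2 N.+2 x y = tpoly M N x y.
Proof.
move=> y0; rewrite -tpoly_pred2 -tpoly_pred /tpoly.
rewrite [edot y y * _]mulr_sumr [_ * edot (bproj x) y * _]mulr_sumr.
rewrite [edot x x * _]mulr_sumr -sumrB -big_split; apply: eq_bigr => k _ /=.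
by rewrite /hterm -(tcoef_mul _ N _ _ y0)/=; ring.
Qed.

(** Both parts of the kernel satisfy this relation: the first because
    Q Q^(-N/2-1) = Q^(-N/2), the second by [tcoef_mul]. *)
Lemma mkernel_mul w M N x y : 0 < sqdist x y -> (w y != 0 -> 0 < edot y y) ->
  edot y y * mkernel w M N.+2 x y
    - 2 * edot (bproj x) y * mkernel w M.-1 N.+2 x y
    + edot x x * mkernel w M.-2 N.+2 x y = mkernel w M N x y.
Proof.
move=> s0 wy; rewrite /mkernel -(sqrtVXD2 N s0).
have [->|w0] := eqVneq (w y) 0; first by rewrite /sqdist; ring.
by rewrite -(tpoly_mul M N x (wy w0)) /sqdist; ring.
Qed.

Lemma is_derive_line_bproj x v y :
  is_derive (0 : R) 1 (fun t : R => - 2 * edot (bproj (t *: v + x)) y)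
    (- 2 * edot (bproj v) y).
Proof.
have d1 : is_derive (0 : R) 1 (fun t : R => t) 1 by exact: is_derive_id.
have c (a : R) : is_derive (0 : R) 1 (fun t : R => a) 0.
  exact: is_derive_cst.
apply: (is_derive_ext (is_derive_cmul (- 2) (is_derive_add
  (is_derive_mul d1 (c (edot (bproj v) y))) (c (edot (bproj x) y))))); last by ring.
by move=> t; rewrite bprojD bprojZ edotDl edotZl.
Qed.

Lemma is_derive_line_edot x v :
  is_derive (0 : R) 1 (fun t : R => edot (t *: v + x) (t *: v + x))
    (2 * edot x v).
Proof.
have d1 : is_derive (0 : R) 1 (fun t : R => t) 1 by exact: is_derive_id.
have c (a : R) : is_derive (0 : R) 1 (fun t : R => a) 0.
  exact: is_derive_cst.
apply: (is_derive_ext (is_derive_add (is_derive_add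
  (is_derive_mul (is_derive_mul d1 d1) (c (edot v v)))
  (is_derive_mul d1 (c (2 * edot x v)))) (c (edot x x)))); last by ring.
by move=> t; rewrite !(edotDl, edotDr, edotZl, edotZr) (edotC v x); ring.
Qed.

Lemma is_derive_hterm k N x v y : 0 < edot y y ->
  is_derive x v (hterm k N ^~ y)
    (- N%:R * (edot x v * hterm k.-2 N.+2 x y
               - edot (bproj v) y * hterm k.-1 N.+2 x y)).
Proof.
move=> y0; apply: is_derive_line.
have cy : is_derive (0 : R) 1 (fun t : R => edot y y) 0.
  exact: is_derive_cst.
apply: (is_derive_ext (@is_derive_tcoef _ k N (fun t => edot y y) _ _ _ _ _ 0 y0 cy
  (is_derive_line_bproj x v y) (is_derive_line_edot x v))) => //.
by rewrite scale0r add0r /hterm; field.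
Qed.

Lemma is_derive_tpoly M N x v y : 0 < edot y y ->
  is_derive x v (tpoly M N ^~ y)
    (- N%:R * (edot x v * tpoly M.-2 N.+2 x y
               - edot (bproj v) y * tpoly M.-1 N.+2 x y)).
Proof.
move=> y0; apply: is_derive_eq.
  exact: (is_derive_bigsum _ (fun k : 'I_M => is_derive_hterm k.+1 N x v y0)).
by rewrite -mulr_sumr sumrB -!mulr_sumr tpoly_pred2 tpoly_pred.
Qed.

(** Both parts of the kernel obey the same differentiation rule, which therefore
    passes to the remainder: each derivative trades one order of the expansion for
    one power of y. *)
Lemma is_derive_mkernel w M N x v y :
  0 < sqdist x y -> (w y != 0 -> 0 < edot y y) ->
  is_derive x v (mkernel w M N ^~ y)
    (- N%:R * (edot x v * mkernel w M.-2 N.+2 x y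
               - edot (bproj v) y * mkernel w M.-1 N.+2 x y)).
Proof.
move=> s0 wy.
have dK : is_derive x v (fun x => sqrtVX N (sqdist x y))
    (- N%:R * (edot x v - edot (bproj v) y) * sqrtVX N.+2 (sqdist x y)).
  apply: is_derive_line.
  have s0' : 0 < sqdist (0 *: v + x) y by rewrite scale0r add0r.
  have cy : is_derive (0 : R) 1 (fun t : R => edot y y) 0.
    exact: is_derive_cst.
  have ds := is_derive_add (is_derive_add cy (is_derive_line_bproj x v y))
    (is_derive_line_edot x v).
  have H := @is_derive1_comp _ (sqrtVX N) (fun t : R => sqdist (t *: v + x) y)
    0 _ _ (is_derive_sqrtVX N s0') ds.
  apply: (is_derive_ext H) => //.
  by rewrite scale0r add0r /sqdist; field.
rewrite /mkernel; have [w0|w0] := eqVneq (w y) 0.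
  rewrite w0; apply: (is_derive_ext dK); first by move=> t; ring.
  by ring.
apply: (is_derive_ext (is_derive_sub dK
  (is_derive_cmul (w y) (is_derive_tpoly M N x v (wy w0))))) => //.
by ring.
Qed.

End kernel.

(** * Size estimates for the modified kernel *)

Section kernel_bounds.
Context {R : realType} {d : nat}.
Implicit Types (x v : 'rV[R]_d.+1) (y : 'rV[R]_d) (k M N e : nat).

(** The weight of the integrability hypothesis, with e = M + d + 1 there. *)
Definition weight e y : R := (enorm y ^+ e + 1)^-1.

Lemma weight_gt0 e y : 0 < weight e y.
Proof. by rewrite invr_gt0 ltr_wpDl// exprn_ge0// enorm_ge0. Qed.

Lemma weight_ge0 e y : 0 <= weight e y.
Proof. exact/ltW/weight_gt0. Qed.

Lemma invX_weight e y : 1 <= enorm y -> enorm y ^- e <= 2 * weight e y.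
Proof.
move=> y1; rewrite /weight -[2]invrK -invfM lef_pV2 ?posrE.
- by have := exprn_ege1 e y1; lra.
- by rewrite exprn_gt0// (lt_le_trans ltr01).
- by rewrite mulr_gt0// ltr_wpDl// exprn_ge0// enorm_ge0.
Qed.

Lemma weight_lb e y (B : R) : enorm y <= B -> (B ^+ e + 1)^-1 <= weight e y.
Proof.
move=> yB; have y0 := enorm_ge0 y; have B0 := le_trans y0 yB.
by rewrite lef_pV2 ?posrE ?ltr_wpDl ?exprn_ge0// lerD2r lerXn2r.
Qed.

Lemma sqrtVX_sqr N (a : R) : 0 <= a -> sqrtVX N (a ^+ 2) = a ^- N.
Proof. by move=> a0; rewrite /sqrtVX sqrtr_sqr ger0_norm. Qed.

Lemma sqrtVX_le N (a q : R) : 0 < a -> a ^+ 2 <= q -> sqrtVX N q <= a ^- N.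
Proof.
move=> a0 aq; have q0 : 0 < q by apply: lt_le_trans aq; rewrite exprn_gt0.
rewrite /sqrtVX lef_pV2 ?posrE ?exprn_gt0 ?sqrtr_gt0// lerXn2r ?nnegrE//.
- exact: ltW.
- by rewrite -(ger0_norm (ltW a0)) -sqrtr_sqr ler_wsqrtr.
Qed.

Lemma hterm_bound k N : exists2 C : R, 0 <= C & forall x y, 0 < enorm y ->
  `|hterm k.+1 N x y| <= C * (enorm x ^+ k / enorm y ^+ (k + N)).
Proof.
have [C C0 HC] := @tcoef_bound R k N; exists (C * 2 ^+ k).
  by rewrite mulr_ge0// exprn_ge0.
move=> x y y0; have x0 := enorm_ge0 x; have yn0 : enorm y != 0 by rewrite gt_eqF.
apply: le_trans (HC (2 * enorm x / enorm y) _ _ _ _ _ _ _) _.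
- by rewrite -enorm_sqr exprn_gt0.
- by rewrite !mulr_ge0// invr_ge0 ltW.
- rewrite -enorm_sqr normrM normrN [`|2|]ger0_norm//.
  rewrite [X in _ <= X](_ : _ = 2 * (enorm x * enorm y)); last by field.
  rewrite ler_wpM2l// (le_trans (edot_enorm _ _))//.
  by rewrite ler_wpM2r ?enorm_bproj// ltW.
- rewrite -!enorm_sqr ger0_norm ?sqr_ge0//.
  rewrite [X in _ <= X](_ : _ = 4 * enorm x ^+ 2); last by field.
  by have := sqr_ge0 (enorm x); lra.
rewrite -enorm_sqr sqrtVX_sqr ?enorm_ge0// exprD !exprMn exprVn.
by rewrite le_eqVlt; apply/orP; left; apply/eqP; field; rewrite !expf_neq0.
Qed.

Lemma tpoly_bound M N : exists2 C : R, 0 <= C & forall x y (b : R),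
  0 < enorm y -> 0 <= b ->
  (forall k, (k < M)%N -> enorm x ^+ k / enorm y ^+ (k + N) <= b) ->
  `|tpoly M N x y| <= C * b.
Proof.
elim: M => [|M [C C0 HC]].
  by exists 0 => // x y b _ _ _; rewrite /tpoly big_ord0 normr0 mul0r.
have [C' C'0 HC'] := hterm_bound M N; exists (C + C'); first exact: addr_ge0.
move=> x y b y0 b0 hb; rewrite /tpoly big_ord_recr/= mulrDl.
apply: le_trans (ler_normD _ _) _; apply: lerD.
  by apply: HC => // k kM; apply: hb; rewrite ltnS ltnW.
by apply: le_trans (HC' _ _ y0) _; rewrite ler_wpM2l// hb.
Qed.

(** The Taylor remainder of s |-> Q(s x, y)^(-N/2) on [0, 1]. As |y| >= 2 |x|, all
    the values Q(s x, y) are at least |y|^2 / 4, which makes [tcoef_bound] apply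
    with kap = 12 |x| / |y| at every s. *)
Lemma remainder_bound M N : exists2 C : R, 0 <= C & forall x y,
  0 < enorm y -> 2 * enorm x <= enorm y ->
  `|sqrtVX N (sqdist x y) - tpoly M N x y|
    <= C * (enorm x ^+ M / enorm y ^+ (M + N)).
Proof.
have [C C0 HC] := @tcoef_bound R M N.
exists (M.+1%:R * (C * 12 ^+ M * 2 ^+ N)); first by rewrite !mulr_ge0 ?exprn_ge0.
move=> x y y0 xy; have x0 := enorm_ge0 x; have yn0 : enorm y != 0 by rewrite gt_eqF.
set q := edot y y; set l := - 2 * edot (bproj x) y; set b := edot x x.
have qE : q = enorm y ^+ 2 by rewrite enorm_sqr.
have bE : b = enorm x ^+ 2 by rewrite enorm_sqr.
have lb : `|l| <= 2 * (enorm x * enorm y).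
  rewrite normrM normrN [`|2|]ger0_norm// ler_wpM2l// (le_trans (edot_enorm _ _))//.
  by rewrite ler_wpM2r ?enorm_bproj// ltW.
(* Q(s x, y) >= (|y| - s |x|)^2 and s |x| <= |y| / 2 *)
have Qlb (s : R) : 0 <= s <= 1 -> (enorm y / 2) ^+ 2 <= q + l * s + b * s ^+ 2.
  move=> /andP[s0 s1]; have sx : s * enorm x <= enorm y / 2 by nra.
  have : - (2 * (enorm x * enorm y)) * s <= l * s.
    by rewrite ler_wpM2r// lerNl (le_trans _ lb)// -normrN ler_norm.
  have : 0 <= s * enorm x by rewrite mulr_ge0.
  by rewrite qE bE; nra.
pose g k (s : R) := tcoef k.+1 N (q + l * s + b * s ^+ 2) (l + 2 * b * s) b.
have := @taylor_bound R g M (C * (12 * enorm x / enorm y) ^+ M * (enorm y / 2) ^- N).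
have -> : g 0%N 1 = sqrtVX N (sqdist x y).
  by rewrite /g tcoef1 expr1n !mulr1.
have -> : \sum_(k < M) g k 0 = tpoly M N x y.
  by apply: eq_bigr => k _; rewrite /g expr0n !mulr0 !addr0.
move=> H; apply: le_trans (H _ _) _ => {H}.
- move=> k s s01; apply: is_derive_tcoef_quad.
  by apply: lt_le_trans (Qlb s s01); rewrite exprn_gt0// divr_gt0.
- move=> s s01; have Qs := Qlb s s01.
  have Q0 : 0 < q + l * s + b * s ^+ 2.
    by apply: lt_le_trans Qs; rewrite exprn_gt0// divr_gt0.
  apply: le_trans (HC (12 * enorm x / enorm y) _ _ _ Q0 _ _ _) _.
  + by rewrite divr_ge0 ?mulr_ge0 ?enorm_ge0//.
  + apply: (@le_trans _ _ (12 * enorm x / enorm y * (enorm y / 2) ^+ 2)).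
      rewrite [X in _ <= X](_ : _ = 3 * (enorm x * enorm y)); last by field.
      apply: le_trans (ler_normD _ _) _.
      have /andP[s0 s1] := s01.
      rewrite [`|2 * b * s|]ger0_norm ?mulr_ge0// ?edot_ge0// bE.
      by nra.
    by rewrite ler_wpM2l// divr_ge0 ?mulr_ge0 ?enorm_ge0//.
  + apply: (@le_trans _ _ ((12 * enorm x / enorm y) ^+ 2 * (enorm y / 2) ^+ 2)).
      rewrite [X in _ <= X](_ : _ = 36 * enorm x ^+ 2); last by field.
      by rewrite bE ger0_norm ?sqr_ge0//; have := sqr_ge0 (enorm x); lra.
    by rewrite ler_wpM2l// sqr_ge0.
  rewrite ler_wpM2l ?sqrtVX_le ?divr_gt0// mulr_ge0// exprn_ge0//.
  by rewrite divr_ge0 ?mulr_ge0 ?enorm_ge0//.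
rewrite exprD !exprMn !exprVn.
by rewrite le_eqVlt; apply/orP; left; apply/eqP; field; rewrite !expf_neq0.
Qed.

Section with_cutoff.
Variable w : 'rV[R]_d -> R.
Hypothesis w_range : forall y, 0 <= w y <= 1.
Hypothesis w_eq0 : forall y, enorm y <= 1 -> w y = 0.
Hypothesis w_eq1 : forall y, 2 <= enorm y -> w y = 1.

Lemma cutoff_norm_le1 y : `|w y| <= 1.
Proof. by have /andP[w0 w1] := w_range y; rewrite ger0_norm. Qed.

Lemma cutoff_supp y : w y != 0 -> 1 < enorm y.
Proof. by apply: contraNT; rewrite -leNgt => /w_eq0 ->. Qed.

Lemma cutoff_edot_gt0 y : w y != 0 -> 0 < edot y y.
Proof.
by move=> /cutoff_supp y1; rewrite -enorm_sqr exprn_gt0// (lt_trans ltr01).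
Qed.

(** Reduces a bound on w T_M to bounds on the monomials |x|^k / |y|^(k+N), which
    are needed only outside the unit ball because w vanishes inside it. *)
Lemma cutoff_tpoly_bound M N : exists2 C : R, 0 <= C & forall x y (b : R),
  0 <= b -> (1 <= enorm y -> forall k, (k < M)%N ->
    enorm x ^+ k / enorm y ^+ (k + N) <= b) ->
  `|w y * tpoly M N x y| <= C * b.
Proof.
have [C C0 HC] := tpoly_bound M N; exists C => // x y b b0 hb.
have [->|w0] := eqVneq (w y) 0; first by rewrite mul0r normr0 mulr_ge0.
have y1 := cutoff_supp w0.
rewrite normrM -[X in _ <= X]mul1r ler_pM// ?cutoff_norm_le1//.
by apply: HC => //; [rewrite (lt_trans ltr01)|apply: hb; rewrite ltW].
Qed.

Lemma cutoff_tpoly_bound_local M N (rho : R) : 0 <= rho ->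
  exists2 C : R, 0 <= C & forall x y,
    enorm x <= rho -> `|w y * tpoly M N x y| <= C.
Proof.
move=> rho0; have [C C0 HC] := cutoff_tpoly_bound M N.
exists (C * (rho + 1) ^+ M); first by rewrite mulr_ge0 ?exprn_ge0 ?addr_ge0.
move=> x y xrho; apply: HC; first by rewrite exprn_ge0 ?addr_ge0.
move=> y1 k kM; rewrite -[X in _ <= X]mulr1 ler_pM
    ?exprn_ge0 ?invr_ge0 ?exprn_ge0 ?enorm_ge0//.
  apply: (@le_trans _ _ ((rho + 1) ^+ k)).
    by rewrite lerXn2r ?nnegrE ?addr_ge0 ?enorm_ge0// (le_trans xrho) ?lerDl.
  by rewrite ler_weXn2l ?lerDr// ltnW.
by rewrite invf_le1 ?exprn_ege1// exprn_gt0// (lt_le_trans ltr01).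
Qed.

(** Far out, where |y| >= 2 rho + 2, the kernel is a Taylor remainder. On the rest
    the weight is bounded below, and the kernel is bounded above because Q >= eta^2
    keeps y away from x and w keeps it away from 0. *)
Lemma mkernel_bound M N (rho eta : R) : 0 <= rho -> 0 < eta ->
  exists2 C : R, 0 <= C & forall x y, enorm x <= rho ->
    eta ^+ 2 <= sqdist x y -> `|mkernel w M N x y| <= C * weight (M + N) y.
Proof.
move=> rho0 eta0; have [C C0 HC] := remainder_bound M N.
have [C' C'0 HC'] := cutoff_tpoly_bound_local M N rho0.
set B := 2 * rho + 2; have B0 : 0 <= B by rewrite addr_ge0// mulr_ge0.
exists (2 * (C * rho ^+ M) + (eta ^- N + C') * (B ^+ (M + N) + 1)).
  rewrite addr_ge0 ?mulr_ge0 ?addr_ge0 ?exprn_ge0// invr_ge0 exprn_ge0//.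
  exact: ltW.
move=> x y xrho etaQ; have x0 := enorm_ge0 x.
have pos1 : 0 <= (eta ^- N + C') * (B ^+ (M + N) + 1).
  by rewrite mulr_ge0 ?addr_ge0 ?invr_ge0 ?exprn_ge0// ltW.
have pos2 : 0 <= 2 * (C * rho ^+ M) by rewrite !mulr_ge0 ?exprn_ge0.
have [yB|yB] := leP B (enorm y).
  have y1 : 1 <= enorm y by apply: le_trans yB; rewrite /B; lra.
  rewrite mulrDl /mkernel w_eq1; last by apply: le_trans yB; rewrite /B; lra.
  rewrite mul1r; apply: le_trans (HC x y _ _) _; first exact: lt_le_trans y1.
    by apply: le_trans yB; rewrite /B; lra.
  rewrite ler_wpDr ?(mulr_ge0 pos1 (weight_ge0 _ _))//.
  rewrite [X in _ <= X](_ : _ = C * (rho ^+ M * (2 * weight (M + N) y))); last by ring.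
  rewrite ler_wpM2l// ler_pM ?exprn_ge0 ?invr_ge0 ?exprn_ge0 ?enorm_ge0//.
    by rewrite lerXn2r.
  exact: invX_weight.
rewrite mulrDl ler_wpDl ?(mulr_ge0 pos2 (weight_ge0 _ _))//.
apply: (@le_trans _ _ (eta ^- N + C')).
  rewrite (le_trans (ler_normB _ _))// lerD ?HC'//.
  by rewrite ger0_norm ?sqrtVX_ge0 ?sqrtVX_le.
rewrite -[X in X <= _]mulr1 -mulrA ler_wpM2l ?addr_ge0 ?invr_ge0
  ?exprn_ge0 ?(ltW eta0)//.
rewrite -ler_pdivrMl ?ltr_wpDl ?exprn_ge0// mulr1.
by apply: weight_lb; rewrite ltW.
Qed.

Lemma sec_ge1 x k : half_space x -> 1 <= (enorm x / xlast x) ^+ k.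
Proof.
move=> x0; rewrite exprn_ege1// ler_pdivlMr// mul1r.
by rewrite (le_trans (ler_norm _))// coord_enorm.
Qed.

(** With sec = |x| / x_n one has x_n K <= x_n^(-d) = sec^d |x|^(-d), while the
    monomials of T_M contribute multiples of |x|^(k+1) <= |x|^M, as |y| > 1 where w
    does not vanish. *)
Lemma growth_bound_flat M : exists2 C : R, 0 <= C & forall x y,
  half_space x -> 1 <= enorm x ->
  `|xlast x * mkernel w M d.+1 x y|
    <= C * (enorm x ^+ M * (enorm x / xlast x) ^+ d).
Proof.
have [C C0 HC] := cutoff_tpoly_bound M d.+1.
exists (1 + C); first by rewrite addr_ge0.
move=> x y xH x1; have x0 : 0 < xlast x by []; have x0' := ltW x0.
have xx : xlast x <= enorm x.
  by rewrite (le_trans (ler_norm _))// coord_enorm.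
have xM : 1 <= enorm x ^+ M by rewrite exprn_ege1.
have sec1 := sec_ge1 d xH; have e0 : 0 < enorm x by rewrite (lt_le_trans ltr01).
have e0' := ltW e0.
rewrite /mkernel mulrBr mulrDl mul1r (le_trans (ler_normB _ _))// lerD//.
  rewrite ger0_norm ?mulr_ge0 ?sqrtVX_ge0//.
  apply: (@le_trans _ _ (xlast x * xlast x ^- d.+1)).
    by rewrite ler_wpM2l// sqrtVX_le// sqdist_ge_xlast.
  rewrite exprS invfM mulrA divff ?gt_eqF// mul1r expr_div_n.
  rewrite mulrA ler_peMl ?invr_ge0 ?exprn_ge0//.
  by rewrite mulr_ege1// exprn_ege1.
have H := HC x y (enorm x ^+ M / enorm x) _ _.
rewrite [X in X <= _]normrM (gtr0_norm x0).
apply: (@le_trans _ _ (enorm x * (C * (enorm x ^+ M / enorm x)))).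
  apply: ler_pM => //.
  apply: H => [|y1 k kM]; first by rewrite divr_ge0// ltW// exprn_gt0.
  rewrite ler_pdivlMr// mulrAC -exprSr ler_pdivrMr ?exprn_gt0 ?(lt_le_trans ltr01)//.
  rewrite -[X in X <= _]mulr1 ler_pM ?exprn_ege1 ?exprn_ge0//.
  by rewrite ler_weXn2l.
rewrite [X in X <= _](_ : _ = C * (enorm x ^+ M)); last by field; rewrite gt_eqF.
by rewrite ler_wpM2l// ler_peMr// (le_trans ler01).
Qed.

(** For |y| >= 2 |x| this is the Taylor remainder estimate. Otherwise the weight is
    at least of order |x|^(-(M+n)), which is the size of
    x_n K / (|x|^(M+1) sec^d), and (|y| / |x|)^(M-k) <= 2^(M-k) bounds the monomials
    of T_M. *)
Lemma growth_bound_decay M : exists2 C : R, 0 <= C & forall x y,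
  half_space x -> 1 <= enorm x ->
  `|xlast x * mkernel w M d.+1 x y|
    <= C * (enorm x ^+ M.+1 * (enorm x / xlast x) ^+ d) * weight (M + d.+1) y.
Proof.
have [C C0 HC] := cutoff_tpoly_bound M d.+1.
have [C' C'0 HC'] := remainder_bound M d.+1.
set e := (M + d.+1)%N.
exists (2 * C' + (2 ^+ e + 1 + C * (2 ^+ M * 2))).
  by rewrite !addr_ge0 ?mulr_ge0 ?exprn_ge0.
move=> x y xH x1; have x0 : 0 < xlast x by []; have x0' := ltW x0.
have xx : xlast x <= enorm x.
  by rewrite (le_trans (ler_norm _))// coord_enorm.
have sec1 := sec_ge1 d xH; set sec := (_ / _) ^+ d in sec1 *.
have e0 : 0 < enorm x by rewrite (lt_le_trans ltr01).
have e0' := ltW e0; have wt0 := weight_ge0 e y.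
have sec0 : 0 <= sec by apply: le_trans sec1.
have rw0 (k : nat) : 0 <= enorm x ^+ k * weight e y by rewrite mulr_ge0 ?exprn_ge0.
rewrite [X in _ <= X](_ : _ =
    2 * C' * sec * (enorm x ^+ M.+1 * weight e y)
    + (2 ^+ e + 1 + C * (2 ^+ M * 2)) * sec * (enorm x ^+ M.+1 * weight e y));
  last by ring.
have pos1 : 0 <= 2 * C' * sec * (enorm x ^+ M.+1 * weight e y).
  by rewrite mulr_ge0 ?rw0// mulr_ge0// mulr_ge0.
have pos2 : 0 <= (2 ^+ e + 1 + C * (2 ^+ M * 2)) * sec
    * (enorm x ^+ M.+1 * weight e y).
  by rewrite mulr_ge0 ?rw0// mulr_ge0// !addr_ge0 ?mulr_ge0 ?exprn_ge0.
have [xy|xy] := leP (2 * enorm x) (enorm y).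
  rewrite ler_wpDr//.
  have y2 : 2 <= enorm y by lra.
  rewrite /mkernel w_eq1// mul1r normrM gtr0_norm//.
  apply: (@le_trans _ _ (enorm x * (C' * (enorm x ^+ M * (2 * weight e y))))).
    apply: ler_pM => //; apply: le_trans (HC' x y _ xy) _; first lra.
    rewrite ler_wpM2l// ler_wpM2l ?exprn_ge0// invX_weight//; lra.
  rewrite [X in X <= _](_ : _ = 2 * C' * (enorm x ^+ M.+1 * weight e y)).
    by rewrite ler_wpM2r// ler_peMr// mulr_ge0.
  by rewrite exprS; ring.
rewrite ler_wpDl// /mkernel mulrBr 2!mulrDl (le_trans (ler_normB _ _))//.
rewrite lerD//.
  rewrite ger0_norm ?mulr_ge0 ?sqrtVX_ge0//.
  apply: (@le_trans _ _ (xlast x * xlast x ^- d.+1)).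
    by rewrite ler_wpM2l// sqrtVX_le// sqdist_ge_xlast.
  rewrite [X in X <= _](_ : _ = sec * enorm x ^- d); last first.
    rewrite /sec expr_div_n exprS; field.
    by rewrite !expf_neq0 ?gt_eqF.
  rewrite [X in _ <= X](_ : _ = sec * ((2 ^+ e + 1) * enorm x ^+ M.+1 * weight e y));
    last by ring.
  rewrite ler_wpM2l//.
  have wlb : ((2 ^+ e + 1) * enorm x ^+ e)^-1 <= weight e y.
    rewrite lef_pV2 ?posrE ?mulr_gt0 ?exprn_gt0// ?ltr_wpDl ?exprn_ge0 ?enorm_ge0//.
    rewrite mulrDl mul1r -exprMn lerD ?exprn_ege1//.
    by rewrite lerXn2r ?nnegrE ?mulr_ge0 ?enorm_ge0// ltW.
  apply: (@le_trans _ _ ((2 ^+ e + 1) * enorm x ^+ M.+1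
      * ((2 ^+ e + 1) * enorm x ^+ e)^-1)).
    have -> : enorm x ^+ e = enorm x ^+ M.+1 * enorm x ^+ d.
      by rewrite -exprD /e addSnnS.
    have c0 : 2 ^+ e + 1 != 0 :> R by rewrite gt_eqF// ltr_wpDl// exprn_ge0.
    rewrite [X in _ <= X](_ : _ = enorm x ^- d)//; move: c0.
    move: (2 ^+ e + 1) (enorm x ^+ M.+1) (enorm x ^+ d)
      (expf_neq0 M.+1 (lt0r_neq0 e0)) (expf_neq0 d (lt0r_neq0 e0)).
    by move=> a b c b0 c0 a0; field; rewrite a0 b0 c0.
  by rewrite ler_wpM2l// mulr_ge0 ?addr_ge0 ?exprn_ge0.
rewrite [X in X <= _]normrM (gtr0_norm x0).
apply: (@le_trans _ _ (enorm x * (C * (2 ^+ M * 2 * (enorm x ^+ M * weight e y))))).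
  apply: ler_pM => //; apply: HC => [|y1 k kM].
    by rewrite !mulr_ge0 ?exprn_ge0.
  have y0 : 0 < enorm y by lra.
  apply: (@le_trans _ _ (enorm x ^+ k * enorm y ^+ (M - k) / enorm y ^+ e)).
    rewrite /e -{2}(subnK (ltnW kM)) -addnA [X in _ <= X / _]mulrC.
    by rewrite [X in _ / X]exprD invfM mulrACA divff ?mul1r// expf_neq0// gt_eqF.
  rewrite [X in _ <= X](_ : _ = 2 ^+ M * enorm x ^+ M * (2 * weight e y));
    last by ring.
  rewrite ler_pM ?mulr_ge0 ?invr_ge0 ?exprn_ge0 ?invX_weight ?(ltW y0)//.
  apply: (@le_trans _ _ (enorm x ^+ k * (2 * enorm x) ^+ (M - k))).
    by rewrite ler_wpM2l ?exprn_ge0// lerXn2r ?nnegrE ?mulr_ge0 ?enorm_ge0// ltW.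
  rewrite exprMn mulrCA -exprD subnKC ?(ltnW kM)// ler_wpM2r ?exprn_ge0//.
  by rewrite ler_weXn2l ?leq_subr// ler1n.
rewrite [X in X <= _](_ : _ =
  C * (2 ^+ M * 2) * (enorm x ^+ M.+1 * weight e y)); last by rewrite exprS; ring.
by rewrite ler_wpM2r// ler_peMr// !mulr_ge0 ?exprn_ge0.
Qed.

End with_cutoff.

End kernel_bounds.

(** * Borel measurability on row vectors *)

Section row_measurability.
Context {R : realType}.

Lemma measurable_row_ball n (c : 'rV[R]_n) (r : R) : measurable (ball c r).
Proof.
have [r0|r0] := leP r 0.
  rewrite (_ : ball c r = set0) ?seteqP//; split => y // [].
  by rewrite ltNge r0.
rewrite (_ : ball c r = \bigcap_(i in [set: 'I_n])
  (fun y : 'rV[R]_n => y ord0 i) @^-1` ball (c ord0 i) r).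
  apply: fin_bigcap_measurable => // i _.
  rewrite -[X in measurable X]setTI; apply: measurable_coord => //.
  exact: measurable_ball.
apply/seteqP; split => y /=; first by move=> [_ yc] i _ /=; exact: yc.
by move=> yc; split => // i j; rewrite (ord1 i); exact: yc.
Qed.

(** The balls of the sup norm are boxes, hence measurable, and an open set is the
    union of the countably many rational ones that it contains. *)
Lemma open_measurable_row n (U : set 'rV[R]_n) : open U -> measurable U.
Proof.
move=> oU; pose rc (q : 'rV[rat]_n) : 'rV[R]_n := map_mx ratr q.
pose F (p : 'rV[rat]_n * rat) : set 'rV[R]_n :=
  if `[< ball (rc p.1) (ratr p.2) `<=` U >] then ball (rc p.1) (ratr p.2)
  else set0.
rewrite (_ : U = \bigcup_p F p).
  apply: countable_bigcupT_measurable => [|p]; first exact: countableP.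
  rewrite /F.
  by case: asboolP => // _; exact: measurable_row_ball.
apply/seteqP; split => [y Uy|y [p _]]; last first.
  by rewrite /F; case: asboolP => // pU; exact: pU.
have /nbhs_ballP[e /= e0 yeU] := open_nbhs_nbhs (conj oU Uy).
have e20 : 0 < e / 2 by rewrite divr_gt0.
have [r] := rat_in_itvoo e20.
rewrite in_itv/= => /andP[r0 re].
have /choice[q qP] : forall i, exists q : rat, `|ratr q - y ord0 i| < ratr r.
  move=> i; have [q] : exists q : rat,
      ratr q \in `]y ord0 i - ratr r, y ord0 i + ratr r[.
    by apply: rat_in_itvoo; lra.
  by rewrite in_itv/= => qy; exists q; rewrite ltr_distl.
pose c := \row_i q i.
have yc : ball (rc c) (ratr r) y.
  by split => // i j; rewrite !mxE (ord1 i); exact: qP.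
exists (c, r) => //; rewrite /F; case: asboolP => [//|]; apply => z cz.
apply: yeU; apply: le_ball (ball_triangle (ball_sym yc) cz).
by rewrite (splitr e) lerD// ltW.
Qed.

Lemma continuous_measurable_row n (f : 'rV[R]_n -> R) :
  continuous f -> measurable_fun setT f.
Proof.
move=> /continuousP cf; apply: (measurability _ (RGenOpens.measurableE R)).
move=> _ [_ [a [b ->] <-]]; rewrite setTI; apply: open_measurable_row.
exact/cf/interval_open.
Qed.

Lemma measurable_sqrtVX N : measurable_fun setT (@sqrtVX R N).
Proof.
rewrite (_ : @sqrtVX R N = (fun q => q `^ (- N%:R)) \o Num.sqrt).
  apply: measurableT_comp; first exact: measurable_powR.
  apply: continuous_measurable_fun; exact: sqrt_continuous.
by apply/funext => q /=; rewrite powRN powR_mulrn.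
Qed.

Lemma measurable_tcoef d (T : measurableType d) k N (q l b : T -> R) :
  measurable_fun setT q -> measurable_fun setT l -> measurable_fun setT b ->
  measurable_fun setT (fun t => tcoef k N (q t) (l t) (b t)).
Proof.
move=> mq ml mb; move: k N; elim/nat_ind2 => [N|N|k IH1 IH2 N].
- by under eq_fun do rewrite tcoef0; exact: measurable_cst.
- under eq_fun do rewrite tcoef1.
  exact: measurableT_comp (measurable_sqrtVX N) mq.
under eq_fun do rewrite tcoefSS; apply: measurable_funM => //.
apply: measurable_funD; first by apply: measurable_funM => //; exact: IH2.
by apply: measurable_funM; [apply: measurable_funM|exact: IH1].
Qed.

Lemma measurable_edotr n (x : 'rV[R]_n) :
  measurable_fun setT (fun y : 'rV[R]_n => edot x y).
Proof.
apply: measurable_sum => i; apply: measurable_funM => //.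
exact: measurable_coord.
Qed.

Lemma measurable_edot_sqr n : measurable_fun setT (fun y : 'rV[R]_n => edot y y).
Proof. apply: continuous_measurable_row; exact: edot_continuous. Qed.

Lemma measurable_enorm n : measurable_fun setT (@enorm R n).
Proof. apply: continuous_measurable_row; exact: enorm_continuous. Qed.

Lemma measurable_mkernel d (w : 'rV[R]_d -> R) M N (x : 'rV[R]_d.+1) :
  measurable_fun setT w -> measurable_fun setT (mkernel w M N x).
Proof.
move=> mw; have ml : measurable_fun setT (fun y => - 2 * edot (bproj x) y).
  by apply: measurable_funM => //; exact: measurable_edotr.
apply: measurable_funB.
  apply: measurableT_comp (measurable_sqrtVX N) _.
  apply: measurable_funD => //; apply: measurable_funD => //.
  exact: measurable_edot_sqr.
apply: measurable_funM => //; apply: measurable_sum => k.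
by apply: measurable_tcoef => //; exact: measurable_edot_sqr.
Qed.

Lemma measurable_weight d e : measurable_fun setT (@weight R d e).
Proof.
rewrite (_ : weight e = fun y : 'rV[R]_d => (enorm y ^+ e + 1) `^ (- 1)).
  apply: (measurableT_comp (@measurable_powR R (- 1))).
  apply: measurable_funD => //; apply: measurable_funX; exact: measurable_enorm.
by apply/funext => y; rewrite powR_inv1// addr_ge0// exprn_ge0// enorm_ge0.
Qed.

End row_measurability.

(** * Gaussian integrals and the mass of the Poisson kernel *)

Section gaussian.
Context {R : realType}.
Local Notation leb := (@lebesgue_measure R).

Lemma integral_lebesgue_rowS d (f : 'rV[R]_d.+1 -> \bar R) :
  measurable_fun setT f -> (forall y, (0 <= f y)%E) ->
  (\int[lebesgue_row d.+1]_y f y =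
   \int[leb]_t \int[lebesgue_row d]_v f (row_cons (t, v)))%E.
Proof.
move=> mf f0.
have := @ge0_integral_pushforward _ _ _ _ R _ (@measurable_row_cons R d)
  (leb \x lebesgue_row d)%E setT f measurableT mf (fun y _ => f0 y).
rewrite preimage_setT => e; rewrite [LHS]e.
rewrite fubini_tonelli1//; first exact: measurableT_comp mf (@measurable_row_cons R d).
by move=> z; exact: f0.
Qed.

Lemma integral_gauss (c m : R) : c != 0 ->
  (\int[leb]_t (expR (- (c ^+ 2 * (t - m) ^+ 2)))%:E =
   (Num.sqrt pi / `|c|)%:E)%E.
Proof.
move=> c0.
(* the standard deviation for which 2 s^2 = 1 / c^2 *)
pose s : R := (Num.sqrt 2 * `|c|)^-1.
have nc0 : `|c| != 0 by rewrite normr_eq0.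
have s2 : Num.sqrt 2 != 0 :> R by rewrite gt_eqF// sqrtr_gt0.
have s0 : s != 0 by rewrite invr_neq0// mulf_neq0.
have sE : s ^+ 2 *+ 2 = (c ^+ 2)^-1.
  rewrite /s exprVn exprMn sqr_sqrtr// real_normK ?num_real//.
  by rewrite -mulr_natr; field.
have := @integral_normal_pdf R m s.
under eq_integral do rewrite normal_pdfE// /= EFinM.
have nf (t : R) : expR (- (c ^+ 2 * (t - m) ^+ 2)) = normal_fun m s t.
  by rewrite /normal_fun sE invrK mulrC mulNr.
rewrite ge0_integralZl//=; last 3 first.
- apply/measurable_EFinP; exact: measurable_normal_fun.
- by move=> t _; rewrite lee_fin normal_fun_ge0.
- by rewrite lee_fin normal_peak_ge0.
have -> : normal_peak s = (Num.sqrt pi / `|c|)^-1.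
  rewrite /normal_peak -mulrnAl sE sqrtrM ?invr_ge0 ?sqr_ge0// sqrtrV ?sqr_ge0//.
  by rewrite sqrtr_sqr mulrC.
under [in X in _ -> X]eq_integral do rewrite nf.
have p0 : Num.sqrt pi / `|c| != 0 :> R.
  by rewrite mulf_neq0 ?invr_eq0// gt_eqF// sqrtr_gt0 pi_gt0.
move: (\int[_]_t _)%E => I e.
have -> : I = ((Num.sqrt pi / `|c|)%:E * ((Num.sqrt pi / `|c|)^-1%:E * I))%E.
  by rewrite muleA -EFinM divff// mul1e.
by rewrite e mule1.
Qed.

(** The Gaussian is a product over the coordinates, so Tonelli's theorem reduces it
    to one dimension. *)
Lemma integral_row_gauss d (r : R) (m : 'rV[R]_d) : r != 0 ->
  (\int[lebesgue_row d]_y (expR (- (r ^+ 2 * edot (y - m) (y - m))))%:E =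
   ((Num.sqrt pi / `|r|) ^+ d)%:E)%E.
Proof.
move=> r0.
have mg (n : nat) (m' : 'rV[R]_n) : measurable_fun setT
    (fun y : 'rV[R]_n => (expR (- (r ^+ 2 * edot (y - m') (y - m'))))%:E).
  apply/measurable_EFinP; apply: measurableT_comp => //.
  apply: measurableT_comp => //; apply: measurable_funM => //.
  apply: measurable_sum => i; apply: measurable_funM => //.
    under eq_fun do rewrite mxE; apply: measurable_funD => //; exact: measurable_coord.
  under eq_fun do rewrite mxE; apply: measurable_funD => //; exact: measurable_coord.
elim: d m => [|d IH] m.
  rewrite integral_dirac//; last exact: mg.
  transitivity (1 * (expR (- (r ^+ 2 * edot (0 - m) (0 - m))))%:E)%E.
    by congr (_ * _)%E; exact: diracT.
  by rewrite mul1e /edot big_ord0 mulr0 oppr0 expR0 expr0.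
rewrite [LHS](@integral_lebesgue_rowS _ _ (mg d.+1 m)); last first.
  by move=> y; rewrite lee_fin expR_ge0.
pose m' : 'rV[R]_d := \row_j m ord0 (lift ord0 j).
transitivity (\int[leb]_t ((expR (- (r ^+ 2 * (t - m ord0 ord0) ^+ 2)))%:E
    * ((Num.sqrt pi / `|r|) ^+ d)%:E))%E.
  apply: eq_integral => t _; rewrite -(IH m') -ge0_integralZl//; last exact: mg.
  apply: eq_integral => v _; rewrite -EFinM -expRD -opprD -mulrDr.
  congr (expR (- (_ * _)))%:E.
  rewrite /edot big_ord_recl !mxE unlift_none/= expr2; congr (_ + _).
  by apply: eq_bigr => i _; rewrite !mxE liftK.
rewrite ge0_integralZr//.
- by rewrite integral_gauss// -EFinM exprS.
- apply/measurable_EFinP; apply: measurableT_comp => //.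
  apply: measurableT_comp => //; apply: measurable_funM => //.
  by apply: measurable_funX; apply: measurable_funB.
Qed.

Lemma integral_dilation (c : R) (G : R -> R) : 0 < c -> continuous G ->
  (forall t, 0 <= G t) ->
  (\int[leb]_t (G t)%:E = c%:E * \int[leb]_t (G (c * t))%:E)%E.
Proof.
move=> c0 cG G0; have d1 (t : R) : is_derive t 1 (fun t : R => c * t) c.
  rewrite -[X in is_derive _ _ _ X]mulr1; apply: is_derive_cmul.
have dE : derive1 (fun t : R => c * t) = cst c.
  by apply/funext => t; rewrite derive1E; have [_ ->] := d1 t.
rewrite (@increasing_ge0_integration_by_substitutionT _ (fun t => c * t) G)//.
- rewrite dE -ge0_integralZl//; last 3 first.
  + apply/measurable_EFinP/measurableT_comp => //.
    exact: continuous_measurable_fun.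
  + by move=> t _; rewrite lee_fin.
  + by rewrite lee_fin ltW.
  by apply: eq_integral => t _; rewrite -EFinM mulrC.
- by move=> t u tu; rewrite ltr_pM2l.
- by rewrite dE; exact: cst_continuous.
- by rewrite dE; exact: is_cvg_cst.
- by rewrite dE; exact: is_cvg_cst.
- by under eq_fun do rewrite mulrC; exact: gt0_cvgMlNy.
- by under eq_fun do rewrite mulrC; exact: gt0_cvgMly.
Qed.

Definition radial_gauss (d : nat) (t : R) : R := `|t| ^+ d * expR (- t ^+ 2).

Lemma radial_gauss_ge0 d t : 0 <= radial_gauss d t.
Proof. by rewrite mulr_ge0 ?exprn_ge0 ?expR_ge0. Qed.

Lemma radial_gauss_continuous d : continuous (radial_gauss d).
Proof.
apply: continuous_mul.
  move=> t; apply: (@continuous_comp _ _ _ (fun t : R => `|t|) (fun u => u ^+ d)).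
    exact: norm_continuous.
  exact: exprn_continuous.
move=> t; apply: continuous_comp; last exact: continuous_expR.
by apply: continuousN; exact: exprn_continuous.
Qed.

(** The substitution t = r^2 shows that this is Gamma ((d + 1) / 2). It is taken over
    the whole line because Gaussian integrals are simplest there. *)
Definition radial_mass (d : nat) : \bar R := (\int[leb]_t (radial_gauss d t)%:E)%E.

Lemma radial_mass_scale d (A : R) : 0 < A ->
  (\int[leb]_t (`|t| ^+ d * expR (- (t ^+ 2 * A)))%:E =
   (sqrtVX d.+1 A)%:E * radial_mass d)%E.
Proof.
move=> A0; have sA0 : 0 < Num.sqrt A by rewrite sqrtr_gt0.
rewrite /radial_mass (@integral_dilation (Num.sqrt A))//; last 2 first.
- exact: radial_gauss_continuous.
- exact: radial_gauss_ge0.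
have -> : (\int[leb]_t (radial_gauss d (Num.sqrt A * t))%:E =
    (Num.sqrt A ^+ d)%:E * \int[leb]_t (`|t| ^+ d * expR (- (t ^+ 2 * A)))%:E)%E.
  rewrite -ge0_integralZl//.
  - apply: eq_integral => t _; rewrite -EFinM /radial_gauss normrM exprMn mulrA.
    by rewrite exprMn sqr_sqrtr ?ltW// gtr0_norm// (mulrC A).
  - apply/measurable_EFinP/measurable_funM.
      by apply: measurable_funX.
    apply: measurableT_comp => //; apply: measurableT_comp => //.
    exact: measurable_funM.
rewrite !muleA -!EFinM /sqrtVX -mulrA -exprS mulVf ?mul1e//.
by rewrite expf_neq0// gt_eqF.
Qed.

(** Writing a power as a Gaussian mixture, A^(-n/2) times the radial mass is the
    integral of |r|^d exp (- r^2 A) over r. For A = Q(x, y) the integral over y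
    becomes Gaussian, by Tonelli: it gives (sqrt pi / |r|)^d exp (- r^2 x_n^2), whose
    product with |r|^d has integral sqrt pi^(d+1) / x_n. *)
Lemma poisson_mass_radial d (x : 'rV[R]_d.+1) : (0 < d)%N -> half_space x ->
  ((\int[lebesgue_row d]_y (xlast x * sqrtVX d.+1 (sqdist x y))%:E)
   * radial_mass d = (Num.sqrt pi ^+ d.+1)%:E)%E.
Proof.
move=> d0 xH; have x0 : 0 < xlast x by [].
pose h (p : 'rV[R]_d * R) : \bar R :=
  (xlast x * (`|p.2| ^+ d * expR (- (p.2 ^+ 2 * sqdist x p.1))))%:E.
have mQ : measurable_fun setT (sqdist x).
  apply: measurable_funD => //; apply: measurable_funD.
    exact: measurable_edot_sqr.
  by apply: measurable_funM => //; exact: measurable_edotr.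
have mh : measurable_fun setT h.
  apply/measurable_EFinP; apply: measurable_funM => //; apply: measurable_funM.
    by apply: measurable_funX; apply: measurableT_comp.
  apply: measurableT_comp => //; apply: measurableT_comp => //.
  apply: measurable_funM; first exact: measurable_funX.
  exact: measurableT_comp mQ _.
have h0 p : (0 <= h p)%E.
  by rewrite lee_fin !mulr_ge0 ?exprn_ge0 ?expR_ge0// ltW.
have radial0 : (0 <= radial_mass d)%E.
  by apply: integral_ge0 => t _; rewrite lee_fin radial_gauss_ge0.
transitivity (\int[lebesgue_row d]_y \int[leb]_t h (y, t))%E.
  rewrite -ge0_integralZr//; last 2 first.
  - apply/measurable_EFinP; apply: measurable_funM => //.
    exact: measurableT_comp (measurable_sqrtVX _) mQ.
  - by move=> y _; rewrite lee_fin mulr_ge0 ?sqrtVX_ge0 ?ltW.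
  apply: eq_integral => y _; rewrite EFinM -muleA -radial_mass_scale; last first.
    exact: sqdist_half_space.
  rewrite -ge0_integralZl//.
  - apply/measurable_EFinP; apply: measurable_funM.
      by apply: measurable_funX.
    apply: measurableT_comp => //; apply: measurableT_comp => //.
    exact: measurable_funM.
  - by rewrite lee_fin ltW.
rewrite fubini_tonelli//.
have mT0 : measurable ([set: measurableTypeR R] `\ 0).
  by apply: measurableD => //; exact: measurable_set1.
(* the inner Gaussian integral is finite only for r != 0 *)
rewrite -(@integral_setD1 _ _ 0)//; last first.
  apply: measurable_funTS; exact: measurable_fun_fubini_tonelli_G.
transitivity (\int[leb]_(t in [set: R] `\ 0%R)
    ((xlast x * Num.sqrt pi ^+ d)%:E * (expR (- (xlast x ^+ 2 * (t - 0) ^+ 2)))%:E))%E.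
  apply: eq_integral => t; rewrite inE => -[_ /= t0].
  have {}t0 : t != 0 by apply/eqP.
  pose c := xlast x * (`|t| ^+ d * expR (- (t ^+ 2 * xlast x ^+ 2))).
  transitivity (\int[lebesgue_row d]_y (c%:E *
      (expR (- (t ^+ 2 * edot (y - bproj x) (y - bproj x))))%:E))%E.
    apply: eq_integral => y _; rewrite -EFinM /h /c/=; congr EFin.
    rewrite sqdistE enorm_sqr mulrDr opprD expRD; ring.
  rewrite ge0_integralZl//.
  - rewrite integral_row_gauss// -!EFinM /c expr_div_n; congr EFin.
    rewrite subr0 (mulrC (t ^+ 2)) [LHS](_ : _ = xlast x * Num.sqrt pi ^+ d
      * expR (- (xlast x ^+ 2 * t ^+ 2)) * (`|t| ^+ d / `|t| ^+ d)); last by ring.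
    by rewrite divff ?mulr1// expf_neq0// normr_eq0.
  - apply/measurable_EFinP; apply: measurableT_comp => //.
    apply: measurableT_comp => //; apply: measurable_funM => //.
    apply: measurable_sum => i; apply: measurable_funM => //.
      under eq_fun do rewrite mxE; apply: measurable_funD => //.
      exact: measurable_coord.
    under eq_fun do rewrite mxE; apply: measurable_funD => //.
    exact: measurable_coord.
  - by rewrite lee_fin !mulr_ge0 ?exprn_ge0 ?expR_ge0// ltW.
have mg : measurable_fun setT
    (fun t : R => (expR (- (xlast x ^+ 2 * (t - 0) ^+ 2)))%:E).
  apply/measurable_EFinP; apply: measurableT_comp => //.
  apply: measurableT_comp => //; apply: measurable_funM => //.
  by apply: measurable_funX; apply: measurable_funB.
rewrite integral_setD1//; last by apply: measurable_funTS; exact: measurable_funeM.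
rewrite ge0_integralZl//.
- rewrite integral_gauss ?gt_eqF// gtr0_norm// -EFinM exprS; congr EFin.
  by field; rewrite gt_eqF.
- by rewrite lee_fin mulr_ge0 ?exprn_ge0// ltW.
Qed.

End gaussian.

Section gamma_half_integer.
Context {R : realType}.
Local Notation leb := (@lebesgue_measure R).

Lemma integral_expRN (a : R) :
  (\int[leb]_(t in `]a, +oo[) (expR (- t))%:E = (expR (- a))%:E)%E.
Proof.
have cE : continuous (fun t : R => expR (- t)).
  move=> t; apply: continuous_comp; last exact: continuous_expR.
  exact: opp_continuous.
have dE (t : R) : is_derive t 1 (fun t : R => - expR (- t)) (expR (- t)).
  have dN : is_derive t 1 (fun t : R => - t) (- 1).
    exact: is_deriveNid.
  have := @is_derive1_comp _ expR (fun t : R => - t) t _ _ (is_derive_expR (- t)) dN.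
  move=> /(is_derive_cmul (- 1)) H; apply: (is_derive_ext H); last by ring.
  by move=> u /=; ring.
rewrite integral_itv_obnd_cbnd; last first.
  apply/measurable_EFinP/measurable_funTS; exact: continuous_measurable_fun.
rewrite (@ge0_continuous_FTC2y _ _ (fun t : R => - expR (- t)) _ 0).
- by rewrite -EFinB sub0r opprK.
- by move=> t _; exact: expR_ge0.
- exact: continuous_subspaceT.
- by rewrite -oppr0; apply: cvgN; exact: cvgr_expR.
- by move=> t _; have [] := dE t.
- apply: cvg_at_right_filter; apply: cvgN; exact: cE.
- by move=> t _; rewrite derive1E; have [_ ->] := dE t.
Qed.

Lemma integral_monomial (d : nat) (a : R) : 0 < a ->
  (\int[leb]_(r in `[0%R, a[) (d.+1%:R * r ^+ d)%:E = (a ^+ d.+1)%:E)%E.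
Proof.
move=> a0.
have cX : continuous (fun r : R => d.+1%:R * r ^+ d).
  by apply: continuous_mul; [exact: cst_continuous|exact: exprn_continuous].
have dX (r : R) : is_derive r 1 (fun r : R => r ^+ d.+1) (d.+1%:R * r ^+ d).
  have did : is_derive r 1 (fun t : R => t) 1 by exact: is_derive_id.
  apply: (is_derive_ext (is_deriveX d.+1 did)).
    by move=> t; rewrite exprfctE.
  exact: mulr1.
rewrite integral_itv_bndo_bndc; last first.
  apply/measurable_EFinP/measurable_funTS; exact: continuous_measurable_fun.
rewrite (@continuous_FTC2 _ _ (fun r : R => r ^+ d.+1)).
- by rewrite -EFinB expr0n subr0.
- exact: a0.
- exact: continuous_subspaceT.
- split.
  + by move=> r _; have [] := dX r.
  + apply: cvg_at_right_filter; exact: exprn_continuous.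
  + apply: cvg_at_left_filter; exact: exprn_continuous.
- by move=> r _; rewrite derive1E; have [_ ->] := dX r.
Qed.

(** This is Gamma (1 + n/2) = (n/2) Gamma (n/2). By Tonelli over the region
    0 <= r, r^2 < t: the function t^(n/2) is the integral of n r^(n-1) over
    r < sqrt t, and exp (- r^2) is the integral of exp (- t) over t > r^2. This
    avoids both a substitution and an integration by parts on a half line. *)
Lemma gamma_radial (d : nat) :
  (\int[leb]_(t in `]0%R, +oo[) (t `^ (d.+1%:R / 2) * expR (- t))%:E =
   (d.+1%:R / 2)%:E * @radial_mass R d)%E.
Proof.
pose f (p : R * R) : \bar R := (if (0 <= p.2) && (p.2 ^+ 2 < p.1) then
  d.+1%:R * p.2 ^+ d * expR (- p.1) else 0)%:E.
have mf : measurable_fun setT f.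
  apply/measurable_EFinP; apply: measurable_fun_ifT => //.
    apply: measurable_and; first exact: measurable_fun_ler.
    by apply: measurable_fun_ltr => //; exact: measurable_funX.
  apply: measurable_funM; first by apply: measurable_funM => //; exact: measurable_funX.
  by apply: measurableT_comp => //; apply: measurableT_comp.
have f0 p : (0 <= f p)%E.
  rewrite lee_fin; case: ifPn => // /andP[p0 _].
  by rewrite !mulr_ge0 ?exprn_ge0 ?expR_ge0.
transitivity (\int[leb]_t \int[leb]_r f (t, r))%E.
  rewrite [LHS]integral_mkcond; apply: eq_integral => t _.
  rewrite patchE; case: ifPn => [|].
    rewrite inE/= in_itv/= andbT => t0.
    have st0 : 0 < Num.sqrt t by rewrite sqrtr_gt0.
    transitivity (\int[leb]_(r in `[0%R, Num.sqrt t[)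
        ((d.+1%:R * r ^+ d)%:E * (expR (- t))%:E))%E.
      rewrite ge0_integralZr//.
      - rewrite integral_monomial// -EFinM; congr (_ * _)%:E.
        by rewrite mulrC powRrM powR12_sqrt ?ltW// powR_mulrn.
      - apply/measurable_EFinP; apply: measurable_funM => //.
      - move=> r; rewrite /= in_itv/= => /andP[r0 _].
        by rewrite lee_fin mulr_ge0 ?exprn_ge0.
    rewrite integral_mkcond; apply: eq_integral => r _.
    rewrite patchE /f mem_setE in_itv/=; have [r0|//] := leP 0 r.
    rewrite -EFinM; suff -> : (r < Num.sqrt t) = (r ^+ 2 < t) by case: ifP.
    by rewrite -[X in _ = (_ < X)](sqr_sqrtr (ltW t0)) ltr_pXn2r// nnegrE ltW.
  rewrite notin_setE/= in_itv/= andbT => /negP; rewrite -leNgt => t0.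
  rewrite integral0_eq// => r _; rewrite /f/= ltNge (le_trans t0) ?sqr_ge0//.
  by rewrite andbF.
rewrite fubini_tonelli//.
transitivity (\int[leb]_(r in [set r : R | (0 <= r)%R])
   (d.+1%:R%:E * (radial_gauss d r)%:E))%E.
  rewrite [RHS]integral_mkcond; apply: eq_integral => r _.
  rewrite patchE; case: ifPn => [|]; last first.
    rewrite notin_setE/= => /negP; rewrite -ltNge => r0.
    by rewrite integral0_eq// => t _; rewrite /f/= leNgt r0.
  rewrite inE/= => r0.
  transitivity (\int[leb]_(t in `](r ^+ 2)%R, +oo[)
      ((d.+1%:R * r ^+ d)%:E * (expR (- t))%:E))%E.
    rewrite [RHS]integral_mkcond; apply: eq_integral => t _.
    by rewrite patchE mem_setE in_itv/= andbT /f/= r0/=; case: ifP.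
  rewrite ge0_integralZl//.
  - by rewrite integral_expRN -!EFinM /radial_gauss ger0_norm// mulrA.
  - apply/measurable_EFinP; apply: measurableT_comp => //.
  - by rewrite lee_fin mulr_ge0 ?exprn_ge0.
have mD : measurable [set r : measurableTypeR R | (0 <= r)%R].
  by rewrite -set_itvcy.
rewrite ge0_integralZl//.
- rewrite /radial_mass ge0_symfun_integralT//.
  + by rewrite muleA -EFinM divfK.
  + exact: radial_gauss_ge0.
  + exact: radial_gauss_continuous.
  + by move=> r /=; rewrite /radial_gauss normrN sqrrN.
- apply/measurable_EFinP; apply: measurable_funTS.
  by apply: continuous_measurable_fun; exact: radial_gauss_continuous.
- by move=> r _; rewrite lee_fin radial_gauss_ge0.
Qed.

(** The product of the mass of x_n K and the radial mass is the finite and nonzero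
    number sqrt pi^n, so both factors are finite; [gamma_radial] relates the
    second one to the Gamma value in alpha_const. *)
Lemma poisson_mass (d : nat) (x : 'rV[R]_d.+1) : (0 < d)%N -> half_space x ->
  (lebesgue_row d).-integrable setT
    (fun y => (sqrtVX d.+1 (sqdist x y))%:E) /\
  alpha_const d.+1 * xlast x *
    \int[lebesgue_row d]_y sqrtVX d.+1 (sqdist x y) = 1.
Proof.
move=> d0 xH; have x0 : 0 < xlast x by [].
have := poisson_mass_radial d0 xH; have := gamma_radial d.
set I := (\int[lebesgue_row d]_y _)%E; set C := radial_mass d => gC IC.
have mK : measurable_fun setT (fun y => sqrtVX d.+1 (sqdist x y)).
  apply: measurableT_comp (measurable_sqrtVX _) _.
  apply: measurable_funD => //; apply: measurable_funD.
    exact: measurable_edot_sqr.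
  by apply: measurable_funM => //; exact: measurable_edotr.
have C0 : (0 <= C)%E.
  by apply: integral_ge0 => t _; rewrite lee_fin radial_gauss_ge0.
pose J := (\int[lebesgue_row d]_y (sqrtVX d.+1 (sqdist x y))%:E)%E.
have J0 : (0 <= J)%E.
  by apply: integral_ge0 => y _; rewrite lee_fin sqrtVX_ge0.
have IE : I = ((xlast x)%:E * J)%E.
  rewrite /I; under eq_integral do rewrite EFinM.
  rewrite ge0_integralZl//; first exact/measurable_EFinP.
  - by move=> y _; rewrite lee_fin sqrtVX_ge0.
  - by rewrite lee_fin ltW.
have pi0 : 0 < Num.sqrt pi ^+ d.+1 :> R by rewrite exprn_gt0// sqrtr_gt0 pi_gt0.
have [Cf Jf] : C \is a fin_num /\ J \is a fin_num.
  move: IC; rewrite IE; case: C C0 {gC} => [c| |]// C0;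
    case: J J0 {IE} => [j| |]// J0 IC.
  - exfalso; move: IC; rewrite gt0_muley ?lte_fin//.
    have [->|c0] := eqVneq c 0; first by rewrite mule0 => -[] e; rewrite e ltxx in pi0.
    by rewrite gt0_mulye// lt_def eqe c0.
  - exfalso; move: IC; rewrite -EFinM.
    have [->|j0] := eqVneq j 0.
      by rewrite mulr0 mul0e => -[] e; rewrite e ltxx in pi0.
    by rewrite gt0_muley// lte_fin mulr_gt0// lt_def j0.
  - by exfalso; move: IC; rewrite -muleA mulyy gt0_muley ?lte_fin.
split.
  apply/integrableP; split; first exact/measurable_EFinP.
  under eq_integral do rewrite gee0_abs ?lee_fin ?sqrtVX_ge0//.
  by rewrite -/J ltey_eq Jf.
have -> : \int[lebesgue_row d]_y sqrtVX d.+1 (sqdist x y) = fine J by [].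
have jc : xlast x * fine J * fine C = Num.sqrt pi ^+ d.+1.
  by move: IC; rewrite IE -(fineK Cf) -(fineK Jf) -!EFinM => -[].
have gE : Gamma_fun (1 + d.+1%:R / 2) = d.+1%:R / 2 * fine C.
  rewrite /Gamma_fun /Rintegral -(fineM (x := (d.+1%:R / 2)%:E))// -gC.
  by congr fine; apply: eq_integral => t _; rewrite addrAC subrr add0r.
have c0 : fine C != 0.
  by apply/eqP => c0; move: pi0; rewrite -jc c0 mulr0 ltxx.
have pE : pi `^ (d.+1%:R / 2) = xlast x * fine J * fine C.
  by rewrite jc mulrC powRrM powR12_sqrt ?pi_ge0// powR_mulrn ?sqrtr_ge0.
have j0 : fine J != 0.
  by apply/eqP => j0; move: pi0; rewrite -jc j0 mulr0 mul0r ltxx.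
rewrite /alpha_const /omega_ball gE pE; field.
by rewrite c0 j0 (gt_eqF x0) nat1r pnatr_eq0.
Qed.

End gamma_half_integer.

(** * Weighted kernel integrals and differentiation under the integral *)

Lemma continuous_at_dist (R : realType) (V : normedModType R) (f : V -> R) (x : V) :
  (forall e, 0 < e -> \forall z \near x, `|f x - f z| <= e) ->
  {for x, continuous f}.
Proof. by move=> H; apply/cvgrPdist_le. Qed.

Lemma enorm_sub_continuous (R : realType) n (a : 'rV[R]_n) :
  continuous (fun z : 'rV[R]_n => enorm (z - a)).
Proof.
move=> z; have sub_cont (V : normedModType R) (b c : V) :
    {for b, continuous (fun t : V => t - c)}.
  by apply: cvgB; [exact: cvg_id|exact: cvg_cst].
apply: (@continuous_comp 'rV[R]_n 'rV[R]_n R (fun z => z - a) (@enorm R n)).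
  exact: (@sub_cont 'rV[R]_n).
exact: enorm_continuous.
Qed.

Section weighted_integrals.
Context {R : realType} {d : nat}.
Variable w : 'rV[R]_d -> R.
Hypothesis w_meas : measurable_fun setT w.
Hypothesis w_range : forall y, 0 <= w y <= 1.
Hypothesis w_eq0 : forall y, enorm y <= 1 -> w y = 0.
Hypothesis w_eq1 : forall y, 2 <= enorm y -> w y = 1.
Implicit Types (x v : 'rV[R]_d.+1) (y : 'rV[R]_d) (M N e : nat).
Local Notation mu := (lebesgue_row d).
Local Notation mk := (mkernel w).

Lemma weight_le_mono e e' y : (e <= e')%N -> weight e' y <= 2 * weight e y.
Proof.
move=> ee'; have y0 := enorm_ge0 y.
rewrite /weight -[2]invrK -invfM lef_pV2 ?posrE ?mulr_gt0 ?ltr_wpDl ?exprn_ge0//.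
rewrite ler_pdivrMl//.
have [y1|y1] := leP 1 (enorm y).
  have := ler_weXn2l y1 ee'; have := exprn_ge0 e' y0; lra.
by have := exprn_ile1 e y0 (ltW y1); have := exprn_ge0 e' y0; lra.
Qed.

Lemma enorm_weight_le e y : enorm y * weight e.+1 y <= 2 * weight e y.
Proof.
have y0 := enorm_ge0 y; rewrite /weight ler_pdivrMr ?ltr_wpDl ?exprn_ge0//.
rewrite mulrAC ler_pdivlMr ?ltr_wpDl ?exprn_ge0//.
rewrite [enorm y * _]mulrDr mulr1 -exprS.
suff : enorm y <= enorm y ^+ e.+1 + 1 by have := exprn_ge0 e.+1 y0; lra.
have [y1|y1] := leP 1 (enorm y).
  by rewrite ler_wpDr// -{1}(expr1 (enorm y)) ler_weXn2l.
by rewrite ler_wpDl ?exprn_ge0// ltW.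
Qed.

(** The directional derivative of the kernel, see [is_derive_mkernel]. *)
Definition dkernel M N x v y : R :=
  - N%:R * (edot x v * mk M.-2 N.+2 x y - edot (bproj v) y * mk M.-1 N.+2 x y).

(** Differentiation preserves the decay: the exponents of the two kernels are at
    least M + N and M + N + 1, and the second one comes with a factor y. *)
Lemma dkernel_bound M N (rho eta : R) : 0 <= rho -> 0 < eta ->
  exists2 C : R, 0 <= C & forall x v y, enorm x <= rho ->
    eta ^+ 2 <= sqdist x y ->
    `|dkernel M N x v y| <= C * enorm v * weight (M + N) y.
Proof.
move=> rho0 eta0.
have [C1 C10 H1] := mkernel_bound w_range w_eq0 w_eq1 M.-2 N.+2 rho0 eta0.
have [C2 C20 H2] := mkernel_bound w_range w_eq0 w_eq1 M.-1 N.+2 rho0 eta0.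
exists (N%:R * (rho * C1 * 2 + C2 * 4)).
  by rewrite mulr_ge0// addr_ge0// !mulr_ge0.
move=> x v y xrho etaQ; have v0 := enorm_ge0 v; have y0 := enorm_ge0 y.
rewrite /dkernel normrM normrN (ger0_norm (ler0n _ N)) -!mulrA ler_wpM2l//.
rewrite (le_trans (ler_normB _ _))// mulrDl lerD//.
  rewrite normrM.
  apply: (@le_trans _ _ (rho * enorm v * (C1 * (2 * weight (M + N) y)))).
    apply: ler_pM => //.
      by rewrite (le_trans (edot_enorm _ _))// ler_wpM2r.
    rewrite (le_trans (H1 _ _ xrho etaQ))// ler_wpM2l// weight_le_mono//.
    by lia.
  by rewrite le_eqVlt; apply/orP; left; apply/eqP; ring.
rewrite normrM; apply: (@le_trans _ _ (enorm v * enorm y *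
    (C2 * (2 * weight (M + N).+1 y)))).
  apply: ler_pM => //.
    by rewrite (le_trans (edot_enorm _ _))// ler_wpM2r// enorm_bproj.
  rewrite (le_trans (H2 _ _ xrho etaQ))// ler_wpM2l// weight_le_mono//.
  by lia.
rewrite [X in X <= _](_ : _ = C2 * 2 * enorm v * (enorm y * weight (M + N).+1 y));
  last by ring.
rewrite [X in _ <= X](_ : _ = C2 * 2 * enorm v * (2 * weight (M + N) y));
  last by ring.
by rewrite ler_wpM2l ?enorm_weight_le// !mulr_ge0.
Qed.

Definition wintegrable e (phi : 'rV[R]_d -> R) : Prop :=
  measurable_fun setT phi /\
  mu.-integrable setT (fun y => (phi y * weight e y)%:E).

(** Reduces the integrability of integrands with a factor phi to a pointwise bound on
    the other factor. *)
Lemma wintegrable_dom e phi (k : 'rV[R]_d -> R) (C : R) : wintegrable e phi ->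
  measurable_fun setT k -> (forall y, `|k y| <= C * weight e y) ->
  mu.-integrable setT (fun y => (phi y * k y)%:E).
Proof.
move=> [mphi iphi] mk' kC.
have iC := integrableZl measurableT C iphi.
apply: le_integrable iC => //.
  by apply/measurable_EFinP; exact: measurable_funM.
move=> y _; rewrite -EFinM !abse_EFin lee_fin !normrM.
rewrite (ger0_norm (weight_ge0 _ _)) mulrCA ler_wpM2l//.
by apply: le_trans (kC y) _; rewrite ler_wpM2r ?weight_ge0// ler_norm.
Qed.

Lemma wintegrable_leq e e' phi : (e <= e')%N -> wintegrable e phi ->
  wintegrable e' phi.
Proof.
move=> ee' wphi; have [mphi _] := wphi; split => //.
apply: (wintegrable_dom (C := 2) wphi); first exact: measurable_weight.
by move=> y; rewrite ger0_norm ?weight_ge0// weight_le_mono.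
Qed.

Lemma wintegrable_mul e phi (k : 'rV[R]_d -> R) : wintegrable e phi ->
  measurable_fun setT k -> (forall y, `|k y| <= enorm y) ->
  wintegrable e.+1 (fun y => k y * phi y).
Proof.
move=> wphi mk' ky; have [mphi _] := wphi; split; first exact: measurable_funM.
apply: eq_integrable (wintegrable_dom (k := fun y => k y * weight e.+1 y)
  (C := 2) wphi _ _) => //.
- by move=> y _; congr EFin; ring.
- by apply: measurable_funM => //; exact: measurable_weight.
- move=> y; rewrite normrM (ger0_norm (weight_ge0 _ _)).
  by rewrite (le_trans _ (enorm_weight_le _ _))// ler_wpM2r// weight_ge0.
Qed.

Definition kint (phi : 'rV[R]_d -> R) M N x : R :=
  \int[mu]_y (phi y * mk M N x y).

Lemma kint_integrable phi M N x : half_space x -> wintegrable (M + N) phi ->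
  mu.-integrable setT (fun y => (phi y * mk M N x y)%:E).
Proof.
move=> xH wphi.
have [C C0 HC] := mkernel_bound w_range w_eq0 w_eq1 M N (enorm_ge0 x) xH.
apply: (wintegrable_dom (C := C) wphi); first exact: measurable_mkernel.
by move=> y; apply: HC => //; exact: sqdist_ge_xlast.
Qed.

Lemma measurable_dkernel M N x v : measurable_fun setT (dkernel M N x v).
Proof.
apply: measurable_funM => //; apply: measurable_funB.
  by apply: measurable_funM => //; exact: measurable_mkernel.
by apply: measurable_funM; [exact: measurable_edotr|exact: measurable_mkernel].
Qed.

Lemma dkernel_integrable phi M N x v : half_space x -> wintegrable (M + N) phi ->
  mu.-integrable setT (fun y => (phi y * dkernel M N x v y)%:E).
Proof.
move=> xH wphi.
have [C C0 HC] := dkernel_bound M N (enorm_ge0 x) xH.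
apply: (wintegrable_dom (C := C * enorm v) wphi); first exact: measurable_dkernel.
by move=> y; apply: HC => //; exact: sqdist_ge_xlast.
Qed.

Lemma is_derive_mk M N x v y : half_space x ->
  is_derive x v (mk M N ^~ y) (dkernel M N x v y).
Proof.
move=> xH; apply: is_derive_mkernel; first exact: sqdist_half_space.
exact: cutoff_edot_gt0.
Qed.

Lemma half_space_near x h : half_space x -> enorm h <= xlast x / 2 ->
  [/\ half_space (h + x), enorm (h + x) <= enorm x + xlast x
    & forall y, (xlast x / 2) ^+ 2 <= sqdist (h + x) y].
Proof.
move=> xH hx; have x0 : 0 < xlast x by [].
have hl : - (xlast x / 2) <= xlast h.
  rewrite lerNl (le_trans _ hx)// (le_trans _ (coord_enorm h ord_max))//.
  by rewrite -normrN ler_norm.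
have xl : xlast x / 2 <= xlast (h + x).
  by rewrite [X in _ <= X]mxE -/(xlast h) -/(xlast x); lra.
have xhH : 0 < xlast (h + x) by rewrite (lt_le_trans _ xl)// divr_gt0.
split => //.
- by rewrite (le_trans (enormD _ _))// addrC lerD2l (le_trans hx)//; lra.
- move=> y; apply: le_trans (sqdist_ge_xlast _ _).
  by rewrite lerXn2r ?nnegrE// ltW// divr_gt0.
Qed.

(** Moving along v within half the distance to the boundary keeps x in a region
    where [dkernel_bound] is uniform, which dominates the derivative of the
    integrand. *)
Lemma is_derive_kint_int phi M N x v : half_space x -> wintegrable (M + N) phi ->
  is_derive x v (kint phi M N) (\int[mu]_y (phi y * dkernel M N x v y)).
Proof.
move=> xH wphi; have x0 : 0 < xlast x by []; apply: is_derive_line.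
have [mphi iphi] := wphi.
(* for |t| < dl the point t v + x keeps half of its height *)
set dl := xlast x / 2 / (enorm v + 1).
have v1 : 0 < enorm v + 1 by rewrite ltr_wpDl ?enorm_ge0.
have dl0 : 0 < dl by rewrite !divr_gt0.
pose f (t : R) y := phi y * mk M N (t *: v + x) y.
have tx (t : R) : `]- dl, dl[%classic t ->
    [/\ half_space (t *: v + x), enorm (t *: v + x) <= enorm x + xlast x
      & forall y, (xlast x / 2) ^+ 2 <= sqdist (t *: v + x) y].
  rewrite /= in_itv/= -ltr_norml => tdl; apply: half_space_near => //.
  rewrite enormZ; apply: (@le_trans _ _ (dl * (enorm v + 1))).
    by apply: ler_pM => //; [exact: enorm_ge0|exact: ltW|rewrite lerDl].
  by rewrite /dl divfK// gt_eqF.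
have I0 : `]- dl, dl[%classic 0 by rewrite /= in_itv/= oppr_lt0 dl0.
have df (t : R) y : `]- dl, dl[%classic t ->
    is_derive t 1 (f ^~ y) (phi y * dkernel M N (t *: v + x) v y).
  move=> /tx[tH _ _]; apply: is_derive_cmul.
  by apply: (proj2 (is_derive_lineE (mk M N ^~ y) x v t _)); exact: is_derive_mk.
have d1E (t : R) y : `]- dl, dl[%classic t ->
    partial1of2 f t y = phi y * dkernel M N (t *: v + x) v y.
  by move=> tI; rewrite partial1of2E; have [_ ->] := df t y tI.
have [C C0 HC] := dkernel_bound M N
  (addr_ge0 (enorm_ge0 x) (ltW x0)) (divr_gt0 x0 (ltr0n _ 2)).
pose G y := `|phi y * (C * enorm v * weight (M + N) y)|.
have iG : mu.-integrable setT (EFin \o G).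
  have -> : EFin \o G = abse \o
      (fun y => (phi y * (C * enorm v * weight (M + N) y))%:E) by [].
  apply: integrable_abse; apply: (wintegrable_dom (C := C * enorm v) wphi).
    by apply: measurable_funM => //; exact: measurable_weight.
  move=> y; rewrite ger0_norm// mulr_ge0 ?weight_ge0// mulr_ge0//.
  exact: enorm_ge0.
have H1 (t : R) : `]- dl, dl[%classic t -> mu.-integrable setT (EFin \o f t).
  by move=> /tx[tH _ _]; exact: kint_integrable.
have H2 (t : R) y : `]- dl, dl[%classic t -> setT y -> derivable (f ^~ y) t 1.
  by move=> tI _; have [] := df t y tI.
have H3 y : 0 <= G y by rewrite normr_ge0.
have H4 (t : R) y : `]- dl, dl[%classic t -> setT y -> `|partial1of2 f t y| <= G y.
  move=> tI _; rewrite d1E// /G 2!(normrM (phi y)) ler_wpM2l//.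
  have [_ xrho etaQ] := tx t tI; apply: le_trans (HC _ v y xrho (etaQ y)) _.
  exact: ler_norm.
apply: DeriveDef.
  exact: (derivable_under_integral measurableT I0 H1 H2 H3 iG H4).
rewrite -derive1E.
have := differentiation_under_integral measurableT I0 H1 H2 H3 iG H4.
move=> ->; apply: eq_Rintegral => y _.
by rewrite d1E// scale0r add0r.
Qed.

(** The derivative along a segment is bounded by a multiple of its length, so the
    integral is locally Lipschitz by the mean value theorem. *)
Lemma kint_continuous phi M N x : half_space x -> wintegrable (M + N) phi ->
  {for x, continuous (kint phi M N)}.
Proof.
move=> xH wphi; have x0 : 0 < xlast x by []; have [mphi iphi] := wphi.
have [C C0 HC] := dkernel_bound M N
  (addr_ge0 (enorm_ge0 x) (ltW x0)) (divr_gt0 x0 (ltr0n _ 2)).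
pose J := \int[mu]_y `|phi y * weight (M + N) y|.
have J0 : 0 <= J by apply: Rintegral_ge0 => y _; rewrite normr_ge0.
have lip h : enorm h <= xlast x / 2 ->
    `|kint phi M N (h + x) - kint phi M N x| <= C * enorm h * J.
  move=> hx; pose F (t : R) := kint phi M N (t *: h + x).
  have tx (t : R) : t \in `[0, 1] -> half_space (t *: h + x) /\
      (enorm (t *: h + x) <= enorm x + xlast x /\
      forall y, (xlast x / 2) ^+ 2 <= sqdist (t *: h + x) y).
    rewrite in_itv/= => /andP[t0 t1].
    have [|h1 h2 h3] := @half_space_near x (t *: h) xH; last by [].
    rewrite enormZ ger0_norm// (le_trans _ hx)// ler_piMl//; exact: enorm_ge0.
  pose dF (t : R) := \int[mu]_y (phi y * dkernel M N (t *: h + x) h y).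
  have dFP (t : R) : t \in `[0, 1] -> is_derive t 1 F (dF t).
    move=> /tx[tH _]; apply: (proj2 (is_derive_lineE (kint phi M N) x h t _)).
    exact: is_derive_kint_int.
  have dFo (t : R) : t \in `]0, 1[ -> is_derive t 1 F (dF t).
    by move=> t01; apply: dFP; exact: subset_itv_oo_cc.
  have cF : {within `[0, 1], continuous F}.
    apply: derivable_within_continuous => t t01.
    exact: (@ex_derive _ _ _ _ _ _ _ (dFP t t01)).
  have [c c01 e] := MVT_segment (@ler01 R) dFo cF.
  have -> : kint phi M N (h + x) - kint phi M N x = F 1 - F 0.
    by rewrite /F scale1r scale0r add0r.
  rewrite e subr0 mulr1; have [cH [c1 c2]] := tx c c01.
  have id := dkernel_integrable h cH wphi.
  rewrite (le_trans (le_normr_Rintegral measurableT id))//.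
  have iJ : mu.-integrable setT (EFin \o (fun y => `|phi y * weight (M + N) y|)).
    exact: (integrable_abse iphi).
  rewrite /J -RintegralZl//; apply: le_Rintegral => //.
  - exact: (integrable_abse id).
  - exact: (integrableZl measurableT (C * enorm h) iJ).
  move=> y _; rewrite !(normrM (phi y)) [X in _ <= X]mulrCA ler_wpM2l//.
  rewrite (ger0_norm (weight_ge0 _ _)); exact: HC.
apply: (@continuous_at_dist R 'rV[R]_d.+1) => e e0.
have ch : {for x, continuous (fun z : 'rV[R]_d.+1 => enorm (z - x))}.
  exact: enorm_sub_continuous.
have xx : enorm (x - x) = 0 by rewrite subrr /enorm edot0l sqrtr0.
have CJ : 0 < C * J + 1 by rewrite ltr_wpDl ?mulr_ge0.
have h0 : 0 < Num.min (xlast x / 2) (e / (C * J + 1)).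
  by rewrite lt_min !divr_gt0.
near=> z; have : enorm (z - x) <= Num.min (xlast x / 2) (e / (C * J + 1)).
  near: z; apply: (cvgr_le _ ch); first by rewrite xx.
rewrite le_min => /andP[z1 z2].
rewrite distrC -{1}(subrK x z); apply: le_trans (lip _ z1) _.
rewrite mulrAC; apply: (@le_trans _ _ ((C * J + 1) * enorm (z - x))).
  by rewrite ler_wpM2r ?enorm_ge0// lerDl.
by rewrite mulrC -ler_pdivlMr.
Unshelve. all: by end_near. Qed.

End weighted_integrals.

(** * Smoothness and harmonicity of kernel integrals *)

Section smooth_integrals.
Context {R : realType} {d : nat}.
Variable w : 'rV[R]_d -> R.
Hypothesis w_meas : measurable_fun setT w.
Hypothesis w_range : forall y, 0 <= w y <= 1.
Hypothesis w_eq0 : forall y, enorm y <= 1 -> w y = 0.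
Hypothesis w_eq1 : forall y, 2 <= enorm y -> w y = 1.
Implicit Types (x z : 'rV[R]_d.+1) (y : 'rV[R]_d) (M N e : nat) (i : 'I_d.+1).
Local Notation mu := (lebesgue_row d).
Local Notation dir i := (delta_mx ord0 i : 'rV[R]_d.+1).

Lemma half_space_open : open (@half_space R d).
Proof.
rewrite (_ : half_space =
  (fun x : 'rV[R]_d.+1 => x ord0 ord_max) @^-1` [set t | 0 < t]).
  apply: open_comp => [x _|]; first exact: coord_continuous_row.
  exact: open_gt.
by [].
Qed.

Lemma near_half_space x : half_space x -> \forall z \near x, half_space z.
Proof. by move=> xH; exact: (open_nbhs_nbhs (conj half_space_open xH)). Qed.

Lemma continuous_on_eq (u g : 'rV[R]_d.+1 -> R) :
  (forall x, half_space x -> u x = g x) ->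
  continuous_on half_space g -> continuous_on half_space u.
Proof.
move=> ug cg x xH; have nH := near_half_space xH.
rewrite /prop_for /continuous_at (ug x xH) => P /(cg x xH) gP.
have {}gP : \forall z \near x, P (g z) by [].
suff : \forall z \near x, P (u z) by [].
by near=> z; rewrite ug; near: z.
Unshelve. all: by end_near. Qed.

Lemma is_derive_half_space_eq (u g : 'rV[R]_d.+1 -> R) x v (df : R) :
  (forall z, half_space z -> u z = g z) -> half_space x ->
  is_derive x v g df -> is_derive x v u df.
Proof.
move=> ug xH; apply: near_eq_is_derive; near=> z; rewrite ug//; near: z.
exact: near_half_space.
Unshelve. all: by end_near. Qed.

Lemma edot_dir x i : edot x (dir i) = x ord0 i.
Proof.
rewrite /edot (bigD1 i)//= mxE !eqxx mulr1 big1 ?addr0// => j ji.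
by rewrite mxE (negbTE ji) mulr0.
Qed.

(** The i-th coordinate of y seen as a boundary point of the half space: it is 0
    for the last index. *)
Definition bcoord i y : R := edot (bproj (dir i)) y.

Lemma bcoord_le i y : `|bcoord i y| <= enorm y.
Proof.
rewrite (le_trans (edot_enorm _ _))// ler_piMl ?enorm_ge0//.
rewrite (le_trans (enorm_bproj _))// /enorm edot_dir mxE !eqxx.
by rewrite sqrtr1.
Qed.

Lemma measurable_bcoord i : measurable_fun setT (bcoord i).
Proof. exact: measurable_edotr. Qed.

Lemma bproj_sum_dir x : bproj x = \sum_i x ord0 i *: bproj (dir i).
Proof.
apply/rowP => j; rewrite summxE mxE (bigD1 (widen_ord (leqnSn d) j))//=.
rewrite !mxE !eqxx mulr1 big1 ?addr0// => i ij.
by rewrite !mxE eq_sym (negbTE ij) mulr0.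
Qed.

Lemma edot_suml n (I : Type) (r : seq I) (F : I -> 'rV[R]_n) (y : 'rV[R]_n) :
  edot (\sum_(i <- r) F i) y = \sum_(i <- r) edot (F i) y.
Proof.
by elim: r => [|i r IH]; rewrite ?big_nil ?edot0l// !big_cons edotDl IH.
Qed.

Lemma sum_bcoord x y : \sum_i x ord0 i * bcoord i y = edot (bproj x) y.
Proof.
by rewrite bproj_sum_dir edot_suml; apply: eq_bigr => i _; rewrite edotZl.
Qed.

Lemma bcoord_widen (j : 'I_d) y : bcoord (widen_ord (leqnSn d) j) y = y ord0 j.
Proof.
rewrite /bcoord edotC /edot (bigD1 j)//= !mxE !eqxx mulr1 big1 ?addr0// => i ij.
by rewrite !mxE eqxx/= (_ : _ == _ = false) ?mulr0//; exact: negbTE.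
Qed.

Lemma bcoord_max y : bcoord ord_max y = 0.
Proof.
rewrite /bcoord /edot big1// => j _; rewrite !mxE eqxx/=.
by rewrite (_ : _ == _ = false) ?mul0r//; apply/negbTE; rewrite neq_ltn/= ltn_ord.
Qed.

Lemma sum_bcoord_sqr y : \sum_i bcoord i y ^+ 2 = edot y y.
Proof.
rewrite big_ord_recr/= bcoord_max expr0n addr0 /edot.
by apply: eq_bigr => j _; rewrite bcoord_widen expr2.
Qed.

Local Notation G := (mkernel w).
Local Notation I := (kint w).
Let integrableI := kint_integrable w_meas w_range w_eq0 w_eq1.

Lemma wintegrable_bcoord i e phi : wintegrable e phi ->
  wintegrable e.+1 (fun y => bcoord i y * phi y).
Proof.
move=> wphi; apply: wintegrable_mul => //; [exact: measurable_bcoord|].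
exact: bcoord_le.
Qed.

(** The integrated form of [is_derive_mkernel]: a derivative of a kernel integral is
    built from kernel integrals of phi and of y_i phi. *)
Lemma is_derive_kint phi M N x i : half_space x -> wintegrable (M + N) phi ->
  is_derive x (dir i) (I phi M N)
    (- N%:R * (x ord0 i * I phi M.-2 N.+2 x
      - I (fun y => bcoord i y * phi y) M.-1 N.+2 x)).
Proof.
move=> xH wphi.
have d1 := is_derive_kint_int w_meas w_range w_eq0 w_eq1 (dir i) xH wphi.
apply: is_derive_eq d1 _.
have i1 : mu.-integrable setT (fun y => (phi y * G M.-2 N.+2 x y)%:E).
  by apply: integrableI => //; apply: wintegrable_leq wphi; lia.
have i2 : mu.-integrable setT
    (fun y => (bcoord i y * phi y * G M.-1 N.+2 x y)%:E).
  apply: integrableI => //; apply: wintegrable_leq (wintegrable_bcoord i wphi).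
  by lia.
rewrite /kint -RintegralZl// -RintegralB//; last first.
  by exact: (integrableZl measurableT (x ord0 i) i1).
rewrite -RintegralZl//; last first.
  exact: (integrableB measurableT (integrableZl measurableT (x ord0 i) i1) i2).
apply: eq_Rintegral => y _; rewrite /dkernel edot_dir -/(bcoord i y).
by ring.
Qed.

(** The algebra generated by coordinates and kernel integrals. It is closed under
    partial derivatives, which turns C^2 regularity into continuity. *)
Inductive kernel_class : ('rV[R]_d.+1 -> R) -> Prop :=
| kernel_class_cst (c : R) : kernel_class (fun=> c)
| kernel_class_coord i : kernel_class (fun x => x ord0 i)
| kernel_class_kint phi M N : wintegrable (M + N) phi -> kernel_class (I phi M N)
| kernel_class_add f g : kernel_class f -> kernel_class g -> kernel_class (fun x => f x + g x)
| kernel_class_mul f g : kernel_class f -> kernel_class g -> kernel_class (fun x => f x * g x).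

Lemma kernel_class_continuous g : kernel_class g -> continuous_on half_space g.
Proof.
elim=> {g} [c|i|phi M N wphi|f g _ cf _ cg|f g _ cf _ cg] x xH.
- exact: cst_continuous.
- exact: coord_continuous_row.
- exact: (kint_continuous w_meas w_range w_eq0 w_eq1).
- by apply: (@continuousD R _ _ f g); [exact: cf|exact: cg].
- by apply: (@continuousM R _ f g); [exact: cf|exact: cg].
Qed.

Lemma is_derive_coord x v i :
  is_derive x v (fun z : 'rV[R]_d.+1 => z ord0 i) (v ord0 i).
Proof.
apply: is_derive_line.
have did : is_derive (0 : R) 1 (fun t : R => t) 1 by exact: is_derive_id.
have c (a : R) : is_derive (0 : R) 1 (fun t : R => a) 0 by exact: is_derive_cst.
apply: (is_derive_ext (is_derive_add (is_derive_mul did (c (v ord0 i)))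
  (c (x ord0 i)))).
  by move=> t; rewrite !mxE.
by rewrite mul1r mulr0 !addr0.
Qed.

Lemma kernel_class_derive g i : kernel_class g -> exists2 g', kernel_class g' &
  forall x, half_space x -> is_derive x (dir i) g (g' x).
Proof.
elim=> {g} [c|j|phi M N wphi|f g _ [f' kf' df] _ [g' kg' dg]
  |f g kf [f' kf' df] kg [g' kg' dg]].
- by exists (fun=> 0) => [|x _]; [exact: kernel_class_cst|exact: is_derive_cst].
- exists (fun=> dir i ord0 j) => [|x _]; first exact: kernel_class_cst.
  exact: is_derive_coord.
- exists (fun x => - N%:R * (x ord0 i * I phi M.-2 N.+2 x +
      - 1 * I (fun y => bcoord i y * phi y) M.-1 N.+2 x)).
    apply: kernel_class_mul; first exact: kernel_class_cst.
    apply: kernel_class_add; apply: kernel_class_mul.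
    + exact: kernel_class_coord.
    + by apply: kernel_class_kint; apply: wintegrable_leq wphi; lia.
    + exact: kernel_class_cst.
    + apply: kernel_class_kint; apply: wintegrable_leq (wintegrable_bcoord i wphi).
      by lia.
  by move=> x xH; rewrite mulN1r; exact: is_derive_kint.
- exists (fun x => f' x + g' x) => [|x xH]; first exact: kernel_class_add.
  by apply: is_derive_add; [exact: df|exact: dg].
- exists (fun x => f' x * g x + f x * g' x) => [|x xH].
    by apply: kernel_class_add; exact: kernel_class_mul.
  by apply: is_derive_mul; [exact: df|exact: dg].
Qed.

Lemma kernel_class_pderive u g i : kernel_class g -> (forall x, half_space x -> u x = g x) ->
  exists2 g', kernel_class g' & (forall x, half_space x ->
    derivable u x (dir i) /\ pderive i u x = g' x).
Proof.
move=> kg ug; have [g' kg' dg] := kernel_class_derive i kg.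
exists g' => // x xH.
have [d1 d2] : is_derive x (dir i) u (g' x).
  by apply: (is_derive_half_space_eq ug xH); exact: dg.
by [].
Qed.

Lemma kernel_class_C2 u g : kernel_class g -> (forall x, half_space x -> u x = g x) ->
  C2_on half_space u.
Proof.
move=> kg ug; split.
- exact: continuous_on_eq ug (kernel_class_continuous kg).
- move=> i; have [g' kg' dg] := kernel_class_pderive i kg ug; split.
    by move=> x /dg[].
  by apply: continuous_on_eq (kernel_class_continuous kg') => x /dg[].
- move=> i j; have [g' kg' dg] := kernel_class_pderive i kg ug.
  have pg x : half_space x -> pderive i u x = g' x by move=> /dg[].
  have [g'' kg'' dg'] := kernel_class_pderive j kg' pg; split.
    by move=> x /dg'[].
  by apply: continuous_on_eq (kernel_class_continuous kg'') => x /dg'[].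
Qed.

Lemma Rintegral_bigsum (n : nat) (h : 'I_n -> 'rV[R]_d -> R) :
  (forall j, mu.-integrable setT (EFin \o h j)) ->
  \sum_(j < n) \int[mu]_y h j y = \int[mu]_y (\sum_(j < n) h j y).
Proof.
move=> ih; elim: n h ih => [|n IH] h ih.
  rewrite big_ord0; under eq_Rintegral do rewrite big_ord0.
  by rewrite /Rintegral integral0.
rewrite big_ord_recr/= IH; last by move=> j; exact: ih.
rewrite -RintegralD//.
  by apply: eq_Rintegral => y _; rewrite big_ord_recr.
rewrite (_ : _ \o _ = (fun y =>
    \sum_(j < n) (h (widen_ord (leqnSn n) j) y)%:E)%E); last first.
  by apply/funext => y /=; rewrite sumEFin.
by apply: integrable_sum => // j _; exact: ih.
Qed.

(** [mkernel_mul] under the integral sign, with |y|^2 and <x', y> expanded in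
    coordinates so that it matches the sum of the pure second derivatives. *)
Lemma kint_mul phi M N x : half_space x -> wintegrable (M + N) phi ->
  \sum_(i < d.+1) (x ord0 i ^+ 2 * I phi M.-2 N.+2 x
    - 2 * x ord0 i * I (fun y => bcoord i y * phi y) M.-1 N.+2 x
    + I (fun y => bcoord i y * (bcoord i y * phi y)) M N.+2 x) = I phi M N x.
Proof.
move=> xH wphi.
have i1 : mu.-integrable setT (fun y => (phi y * G M.-2 N.+2 x y)%:E).
  by apply: integrableI => //; apply: wintegrable_leq wphi; lia.
have i2 i : mu.-integrable setT
    (fun y => (bcoord i y * phi y * G M.-1 N.+2 x y)%:E).
  apply: integrableI => //; apply: wintegrable_leq (wintegrable_bcoord i wphi).
  by lia.
have i3 i : mu.-integrable setT
    (fun y => (bcoord i y * (bcoord i y * phi y) * G M N.+2 x y)%:E).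
  apply: integrableI => //; rewrite !addnS.
  by do 2 apply: wintegrable_bcoord.
have i1Z i := integrableZl measurableT (x ord0 i ^+ 2) i1.
have i2Z i := integrableZl measurableT (2 * x ord0 i) (i2 i).
have i12 i := integrableB measurableT (i1Z i) (i2Z i).
have i123 i := integrableD measurableT (i12 i) (i3 i).
pose h i y := x ord0 i ^+ 2 * (phi y * G M.-2 N.+2 x y)
  - 2 * x ord0 i * (bcoord i y * phi y * G M.-1 N.+2 x y)
  + bcoord i y * (bcoord i y * phi y) * G M N.+2 x y.
transitivity (\sum_(i < d.+1) \int[mu]_y h i y).
  apply: eq_bigr => i _; rewrite /h RintegralD//; [|exact: (i12 i)|exact: (i3 i)].
  rewrite RintegralB//; [|exact: (i1Z i)|exact: (i2Z i)].
  congr (_ - _ + _).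
    by rewrite RintegralZl//; exact: i1.
  by rewrite RintegralZl//; exact: (i2 i).
rewrite Rintegral_bigsum; last by move=> i; exact: i123.
apply: eq_Rintegral => y _.
rewrite -(mkernel_mul M N (sqdist_half_space y xH) (@cutoff_edot_gt0 _ _ w w_eq0 y)).
rewrite -sum_bcoord_sqr -sum_bcoord.
have -> : edot x x = \sum_i x ord0 i ^+ 2.
  by apply: eq_bigr => i _; rewrite expr2.
rewrite /h big_split/= sumrB.
rewrite [X in X - _ + _](_ : _ = (\sum_i x ord0 i ^+ 2) * (phi y * G M.-2 N.+2 x y));
  last by rewrite mulr_suml.
rewrite [X in _ - X + _](_ : _ =
    2 * (\sum_i x ord0 i * bcoord i y) * (phi y * G M.-1 N.+2 x y)); last first.
  by rewrite mulr_sumr mulr_suml; apply: eq_bigr => i _; ring.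
rewrite [X in _ - _ + X](_ : _ =
    (\sum_i bcoord i y ^+ 2) * (phi y * G M N.+2 x y)); last first.
  by rewrite mulr_suml; apply: eq_bigr => i _; ring.
by ring.
Qed.

Lemma kint_zero M N x : I (fun=> 0) M N x = 0.
Proof.
rewrite /kint; under eq_Rintegral do rewrite mul0r.
by rewrite /Rintegral integral0.
Qed.

(** Let F, A be the integrals against G_M^n and G_(M-2)^(n+2), with n = d + 1. Then
    Laplacian (x_n F) = 2 D_n F + x_n Laplacian F. Here D_n F = - n x_n A because
    the boundary points have no n-th coordinate, and [kint_mul] reduces
    Laplacian F to - n (n A - (n + 2) A) = 2 n A. *)
Lemma kint_harmonic phi M (a : R) (u : 'rV[R]_d.+1 -> R) x :
  wintegrable (M + d.+1) phi ->
  (forall z, half_space z -> u z = a * (xlast z * I phi M d.+1 z)) ->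
  half_space x -> laplacian u x = 0.
Proof.
move=> wphi uE xH; set n := d.+1.
pose b i phi : 'rV[R]_d -> R := fun y => bcoord i y * phi y.
pose dF i z := - n%:R * (z ord0 i * I phi M.-2 n.+2 z - I (b i phi) M.-1 n.+2 z).
pose dA i z := - n.+2%:R *
  (z ord0 i * I phi M.-2.-2 n.+4 z - I (b i phi) M.-2.-1 n.+4 z).
pose dB i z := - n.+2%:R *
  (z ord0 i * I (b i phi) M.-1.-2 n.+4 z - I (b i (b i phi)) M.-1.-1 n.+4 z).
pose del i : R := dir i ord0 ord_max.
have wA : wintegrable (M.-2 + n.+2) phi by apply: wintegrable_leq wphi; lia.
have wB i : wintegrable (M.-1 + n.+2) (b i phi).
  by apply: wintegrable_leq (wintegrable_bcoord i wphi); lia.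
have pu i z : half_space z ->
    pderive i u z = a * (del i * I phi M n z + xlast z * dF i z).
  move=> zH; have D := is_derive_cmul a (is_derive_mul
    (is_derive_coord z (dir i) ord_max) (is_derive_kint i zH wphi)).
  by have [_ e] := is_derive_half_space_eq uE zH D; exact: e.
(* D_i^2 (x_n F) = 2 delta_in D_i F + x_n D_i^2 F *)
have ppu i : pderive i (pderive i u) x =
    a * (2 * del i * dF i x + xlast x * (- n%:R *
      (I phi M.-2 n.+2 x + x ord0 i * dA i x - dB i x))).
  have D1 := is_derive_cmul (del i) (is_derive_kint i xH wphi).
  have D2 := is_derive_cmul (- n%:R) (is_derive_sub
    (is_derive_mul (is_derive_coord x (dir i) i) (is_derive_kint i xH wA))
    (is_derive_kint i xH (wB i))).
  have D := is_derive_cmul a (is_derive_add D1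
    (is_derive_mul (is_derive_coord x (dir i) ord_max) D2)).
  have [_ e] := is_derive_half_space_eq (pu i) xH D.
  have dii : dir i ord0 i = 1 by rewrite mxE !eqxx.
  rewrite [LHS]e dii -/(del i) -/(dA i x) -/(dB i x) /dF /xlast -/n -/(b i phi).
  by ring.
rewrite /laplacian; under eq_bigr do rewrite ppu.
rewrite -mulr_sumr big_split/=.
have -> : \sum_i 2 * del i * dF i x = 2 * dF ord_max x.
  rewrite (bigD1 ord_max)//= big1 ?addr0.
    by rewrite /del mxE !eqxx mulr1.
  by move=> i im; rewrite /del mxE eq_sym (negbTE im) andbF mulr0 mul0r.
have -> : dF ord_max x = - n%:R * (xlast x * I phi M.-2 n.+2 x).
  rewrite /dF (_ : b ord_max phi = fun=> 0) ?kint_zero ?subr0//.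
  by apply/funext => y; rewrite /b bcoord_max mul0r.
rewrite -!mulr_sumr.
have mid : \sum_(i < d.+1) (x ord0 i * dA i x - dB i x) =
    - n.+2%:R * I phi M.-2 n.+2 x.
  rewrite -(kint_mul xH wA) mulr_sumr; apply: eq_bigr => i _.
  by rewrite /dA /dB /b; ring.
under eq_bigr do rewrite -addrA.
rewrite big_split/= mid sumr_const card_ord -/n -[_ *+ n]mulr_natl.
have -> : n.+2%:R = n%:R + 2 :> R by rewrite -addn2 natrD.
by ring.
Qed.

End smooth_integrals.

(** * Angles, Gegenbauer polynomials and the modified kernel *)

Section kernel_interface.
Context {R : realType} {d : nat}.
Implicit Types (x : 'rV[R]_d.+1) (y : 'rV[R]_d) (m M N : nat).

Lemma half_space_enorm_gt0 x : half_space x -> 0 < enorm x.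
Proof.
move=> xH; apply: lt_le_trans (coord_enorm x ord_max).
by apply: lt_le_trans (ler_norm _); exact: xH.
Qed.

Lemma cosine_bound n (u v : 'rV[R]_n) : `|edot u v / (enorm u * enorm v)| <= 1.
Proof.
have [uv0|uv0] := eqVneq (enorm u * enorm v) 0.
  by rewrite uv0 invr0 mulr0 normr0 ler01.
have uv : 0 <= enorm u * enorm v by rewrite mulr_ge0 ?enorm_ge0.
rewrite normf_div (ger0_norm uv) ler_pdivrMr ?mul1r ?edot_enorm//.
by rewrite lt_def uv0.
Qed.

Lemma cos_vangle n (u v : 'rV[R]_n) : u != 0 -> v != 0 ->
  cos (vangle u v) = edot u v / (enorm u * enorm v).
Proof.
move=> u0 v0; rewrite /vangle (negbTE u0) (negbTE v0)/= acosK// in_itv/= -ler_norml.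
exact: cosine_bound.
Qed.

Lemma sin_vangle_ge0 n (u v : 'rV[R]_n) : 0 <= sin (vangle u v).
Proof.
apply: sin_ge0_pi; rewrite /vangle; case: ifP => _.
  by rewrite divr_ge0 ?pi_ge0// ler_pdivrMr// ler_peMr ?pi_ge0// ler1n.
by have [] := acos_def (x := edot u v / (enorm u * enorm v));
  rewrite -?ler_norml ?cosine_bound.
Qed.

Lemma cos_polar_angle x : half_space x ->
  cos (polar_angle x) = xlast x / enorm x.
Proof.
move=> xH; have x0 : x != 0 by rewrite -enorm_gt0 half_space_enorm_gt0.
have e1 : enorm (delta_mx ord0 ord_max : 'rV[R]_d.+1) = 1.
  by rewrite /enorm edot_dir mxE !eqxx sqrtr1.
rewrite /polar_angle cos_vangle//; last by rewrite -enorm_gt0 e1.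
by rewrite edot_dir e1 mulr1.
Qed.

Lemma sin_polar_angle x : half_space x ->
  sin (polar_angle x) = enorm (bproj x) / enorm x.
Proof.
move=> xH; have x0 := half_space_enorm_gt0 xH.
have s0 : 0 <= sin (polar_angle x) by exact: sin_vangle_ge0.
apply/eqP; rewrite -(eqrXn2 (n := 2))// ?divr_ge0 ?enorm_ge0//.
rewrite sin2cos2 cos_polar_angle// !expr_div_n !enorm_sqr.
have xx : edot x x != 0 by rewrite -enorm_sqr expf_neq0// gt_eqF.
have -> : edot (bproj x) (bproj x) = edot x x - xlast x ^+ 2.
  by rewrite (edot_bproj x x) -expr2 addrK.
by apply/eqP; field.
Qed.

(** The right-hand side is the cosine of the angle between x and the boundary point
    y. Its value 0 when x lies on the axis agrees with the convention for angles
    with the zero vector. *)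
Lemma sin_cos_angles x y : half_space x -> y != 0 ->
  sin (polar_angle x) * cos (vangle (bproj x) y) =
  edot (bproj x) y / (enorm x * enorm y).
Proof.
move=> xH y0; rewrite sin_polar_angle//.
have [b0|b0] := eqVneq (bproj x) 0.
  by rewrite b0 edot0l mul0r /enorm edot0l sqrtr0 !mul0r.
rewrite cos_vangle//; field.
by rewrite !enorm_eq0 y0 b0/= -enorm_gt0 half_space_enorm_gt0.
Qed.

Lemma kernelK_sqrtVX N x y : kernelK (N%:R / 2) x y = sqrtVX N (sqdist x y).
Proof.
by rewrite /kernelK -sqdistE sqrtVX_powR// sqdistE addr_ge0// sqr_ge0.
Qed.

(** By homogeneity ([tcoef_scale]), the Gegenbauer terms are the Taylor coefficients
    for (q, l, b) = (|y|^2, -2 <x', y>, |x|^2). *)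
Lemma kernelKM_tpoly M N x y : half_space x -> y != 0 ->
  kernelKM M (N%:R / 2) x y = sqrtVX N (sqdist x y) - tpoly M N x y.
Proof.
move=> xH y0; have x0 := half_space_enorm_gt0 xH.
have ny0 : 0 < enorm y by rewrite enorm_gt0.
rewrite /kernelKM kernelK_sqrtVX; congr (_ - _); apply: eq_bigr => m _.
rewrite sin_cos_angles//; set t := edot _ _ / _.
have t1 : `|t| <= 1.
  rewrite /t normf_div (ger0_norm (mulr_ge0 (ltW x0) (ltW ny0))).
  rewrite ler_pdivrMr ?mulr_gt0// mul1r (le_trans (edot_enorm _ _))//.
  by rewrite ler_wpM2r ?enorm_bproj// ltW.
rewrite gegenbauer_tcoef// [2 * _]mulrC divfK// -natrD powR_mulrn ?ltW//.
rewrite -(tcoef_scale _ _ _ _ _ ny0 ler01) /hterm -!enorm_sqr !mulr1.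
congr (tcoef _ _ _ _ _); rewrite /t; field.
by rewrite !gt_eqF.
Qed.

End kernel_interface.

(** * Boundary values and growth of the Poisson extension *)

Lemma near_continuous_at (R : realType) (V : normedModType R) (f : V -> R) (x : V)
    (e : R) : {for x, continuous f} -> 0 < e ->
  \forall z \near x, `|f x - f z| <= e.
Proof. by move=> /cvgrPdist_le/(_ e) H /H. Qed.

Section poisson_extension.
Context {R : realType} {d : nat}.
Hypothesis d_gt0 : (0 < d)%N.
Variable w : 'rV[R]_d -> R.
Hypothesis w_meas : measurable_fun setT w.
Hypothesis w_range : forall y, 0 <= w y <= 1.
Hypothesis w_eq0 : forall y, enorm y <= 1 -> w y = 0.
Hypothesis w_eq1 : forall y, 2 <= enorm y -> w y = 1.
Variable M : nat.
Variable f : 'rV[R]_d -> R.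
Hypothesis f_cont : continuous f.
Hypothesis f_wint : wintegrable (M + d.+1) f.
Implicit Types (x z : 'rV[R]_d.+1) (y : 'rV[R]_d).
Local Notation mu := (lebesgue_row d).
Local Notation K x y := (sqrtVX d.+1 (sqdist x y)).
Local Notation G := (mkernel w).
Local Notation alpha := (alpha_const d.+1 : R).

Let w_supp y : w y != 0 -> y != 0.
Proof. by move=> /(cutoff_supp w_eq0) y1; rewrite -enorm_gt0 (lt_trans ltr01). Qed.

(** Read off from the mass of the Poisson kernel at one point. *)
Lemma alpha_ge0 : 0 <= alpha.
Proof.
pose e : 'rV[R]_d.+1 := delta_mx ord0 ord_max.
have e1 : xlast e = 1 by rewrite /xlast mxE !eqxx.
have eH : half_space e by rewrite /half_space/= e1.
have [_] := poisson_mass d_gt0 eH; rewrite e1 mulr1 => m1.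
have J0 : 0 <= \int[mu]_y K e y by apply: Rintegral_ge0 => y _; exact: sqrtVX_ge0.
rewrite leNgt; apply/negP => a0.
by have := mulr_le0_ge0 (ltW a0) J0; rewrite m1 leNgt ltr01.
Qed.

(** This weight is at most a multiple of the Poisson kernel at the unit normal. *)
Lemma weight_integrable : mu.-integrable setT (fun y => (weight d.+1 y)%:E).
Proof.
pose e : 'rV[R]_d.+1 := delta_mx ord0 ord_max.
have e1 : xlast e = 1 by rewrite /xlast mxE !eqxx.
have eH : half_space e by rewrite /half_space/= e1.
have [iK _] := poisson_mass d_gt0 eH.
apply: le_integrable (integrableZl measurableT (2 ^+ d.+1) iK) => //.
  by apply/measurable_EFinP; exact: measurable_weight.
move=> y _; rewrite -EFinM !abse_EFin lee_fin ger0_norm ?weight_ge0//.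
rewrite ger0_norm ?mulr_ge0 ?exprn_ge0 ?sqrtVX_ge0//.
have y0 := enorm_ge0 y.
have b0 : bproj e = 0.
  apply/rowP => j; rewrite !mxE eqxx/= (_ : _ == _ = false)//.
  by apply/negbTE; rewrite neq_ltn/= ltn_ord.
have sE : sqdist e y = enorm y ^+ 2 + 1.
  by rewrite sqdistE b0 subr0 e1 expr1n.
have s0 : 0 < Num.sqrt (sqdist e y).
  by rewrite sqrtr_gt0 sE ltr_wpDl ?sqr_ge0.
rewrite /sqrtVX /weight ler_pdivlMr ?exprn_gt0// mulrC ler_pdivrMr; last first.
  by rewrite ltr_wpDl ?exprn_ge0.
have sy : Num.sqrt (sqdist e y) <= enorm y + 1.
  rewrite -ler_sqr ?nnegrE ?sqrtr_ge0 ?addr_ge0//.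
  rewrite sqr_sqrtr sE ?addr_ge0 ?sqr_ge0//; nra.
have [y1|y1] := leP 1 (enorm y).
  apply: (@le_trans _ _ ((2 * enorm y) ^+ d.+1)).
    by rewrite lerXn2r ?nnegrE ?mulr_ge0 ?(ltW s0)//; lra.
  by rewrite exprMn ler_wpM2l ?exprn_ge0// lerDl.
apply: (@le_trans _ _ (2 ^+ d.+1)).
  by rewrite lerXn2r ?nnegrE ?(ltW s0)//; lra.
by rewrite ler_peMr ?exprn_ge0// lerDr exprn_ge0.
Qed.

Lemma cutoff_complement_integrable x : half_space x ->
  mu.-integrable setT (fun y => ((1 - w y) * f y * K x y)%:E).
Proof.
move=> xH; have x0 : 0 < xlast x by [].
apply: (eq_integrable measurableT (fun y => (f y * ((1 - w y) * K x y))%:E)).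
  by move=> y _; congr EFin; ring.
apply: (wintegrable_dom (C := xlast x ^- d.+1 * (2 ^+ (M + d.+1) + 1)) f_wint).
  apply: measurable_funM; first exact: measurable_funB.
  apply: measurableT_comp (measurable_sqrtVX _) _.
  apply: measurable_funD => //; apply: measurable_funD.
    exact: measurable_edot_sqr.
  by apply: measurable_funM => //; exact: measurable_edotr.
move=> y; have [y2|y2] := leP 2 (enorm y).
  rewrite w_eq1// subrr mul0r normr0 mulr_ge0 ?weight_ge0// mulr_ge0//.
  by rewrite invr_ge0 exprn_ge0 ?(ltW x0).
have /andP[w0 w1] := w_range y.
rewrite normrM -mulrA mulrC ler_pM//.
  by rewrite ger0_norm ?sqrtVX_ge0// sqrtVX_le// sqdist_ge_xlast.
apply: (@le_trans _ _ 1); first by rewrite ger0_norm; lra.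
rewrite -ler_pdivrMl ?mulr1; last by rewrite ltr_wpDl ?exprn_ge0.
by apply: weight_lb; exact: ltW.
Qed.

Lemma cutoff_kernel_split x y : half_space x ->
  w y * f y * kernelKM M (d.+1%:R / 2) x y =
  f y * G M d.+1 x y - (1 - w y) * f y * K x y.
Proof.
move=> xH; have [w0|w0] := eqVneq (w y) 0; first by rewrite /mkernel w0; ring.
by rewrite kernelKM_tpoly ?w_supp// /mkernel; ring.
Qed.

Let kint_int x (xH : half_space x) :=
  kint_integrable w_meas w_range w_eq0 w_eq1 xH f_wint.

Lemma cutoff_integrable x : half_space x ->
  mu.-integrable setT (fun y => (w y * f y * kernelKM M (d.+1%:R / 2) x y)%:E).
Proof.
move=> xH.
have := integrableB measurableT (kint_int xH) (cutoff_complement_integrable xH).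
by apply: eq_integrable => // y _; rewrite cutoff_kernel_split.
Qed.

Lemma poisson_extensionE x : half_space x ->
  DM_integral M (fun y => w y * f y) x + D_integral (fun y => (1 - w y) * f y) x =
  alpha * (xlast x * kint w f M d.+1 x).
Proof.
move=> xH; rewrite /DM_integral /D_integral -mulrDr -mulrA.
congr (_ * (_ * _)); rewrite /kint.
under [X in _ + X]eq_Rintegral do rewrite kernelK_sqrtVX.
rewrite -RintegralD//.
- by apply: eq_Rintegral => y _; rewrite cutoff_kernel_split// subrK.
- exact: cutoff_integrable.
- exact: cutoff_complement_integrable.
Qed.

Lemma f_near (y0 : 'rV[R]_d) (e : R) : 0 < e -> exists2 eta : R, 0 < eta <= 1 &
  forall y, enorm (y - y0) <= eta -> `|f y - f y0| <= e.
Proof.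
move=> e0; have fy0 : {for y0, continuous f} by exact: f_cont.
have /nbhs_ballP[r /= r0 ball_f] := @near_continuous_at R 'rV[R]_d f y0 e fy0 e0.
exists (Num.min 1 (r / 2)); first by rewrite lt_min ltr01 divr_gt0//= ge_min lexx.
move=> y; rewrite le_min => /andP[_ yr]; rewrite distrC; apply: ball_f.
split => // i j; rewrite (ord1 i) /ball/= distrC.
have := coord_enorm (y - y0) j; rewrite !mxE => yj.
by rewrite (le_lt_trans (le_trans yj yr))//; lra.
Qed.

(** Near bproj x0, f G_M - f(y0) K differs by a bounded function from
    (f - f(y0)) K, and f hardly varies. Elsewhere the kernels are dominated
    uniformly in x. As alpha_n x_n K has mass one, only terms with a factor x_n
    remain. *)
Lemma poisson_limit (x0 : 'rV[R]_d.+1) (e : R) : xlast x0 = 0 -> 0 < e ->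
  exists2 dl : R, 0 < dl & forall x, half_space x -> enorm (x - x0) <= dl ->
    `|alpha * (xlast x * kint w f M d.+1 x) - f (bproj x0)| <= e.
Proof.
move=> x00 e0; set y0 := bproj x0; have e20 : 0 < e / 2 by rewrite divr_gt0.
have [eta /andP[eta0 eta1] f_eta] := f_near y0 e20.
pose rho := enorm x0 + 1.
have rho0 : 0 <= rho by rewrite addr_ge0 ?enorm_ge0.
have eta20 : 0 < eta / 2 by rewrite divr_gt0.
have [C1 C10 H1] := mkernel_bound w_range w_eq0 w_eq1 M d.+1 rho0 eta20.
(* for M = 0 the modified kernel is K itself *)
have [C2 C20 H2] := mkernel_bound w_range w_eq0 w_eq1 0 d.+1 rho0 eta20.
have [C3 C30 H3] := cutoff_tpoly_bound_local w_range w_eq0 M d.+1 rho0.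
pose B := enorm y0 + 1.
have B0 : 0 <= B by rewrite addr_ge0 ?enorm_ge0.
pose C4 := (`|f y0| + e / 2) * C3 * (B ^+ d.+1 + 1) + `|f y0| * C2.
have C50 : 0 <= (`|f y0| + e / 2) * C3 * (B ^+ d.+1 + 1).
  by rewrite !mulr_ge0// addr_ge0 ?exprn_ge0 ?(ltW e20).
have C40 : 0 <= C4 by rewrite addr_ge0// mulr_ge0.
pose h y := C1 * `|f y * weight (M + d.+1) y| + C4 * weight d.+1 y.
have [_ ifw] := f_wint.
have ih : mu.-integrable setT (EFin \o h).
  exact: (integrableD measurableT
    (integrableZl measurableT C1 (integrable_abse ifw))
    (integrableZl measurableT C4 weight_integrable)).
pose J := \int[mu]_y h y.
have J0 : 0 <= J.
  apply: Rintegral_ge0 => y _.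
  by rewrite addr_ge0 ?mulr_ge0 ?weight_ge0.
have a0 := alpha_ge0.
have aJ0 : 0 <= alpha * J by exact: mulr_ge0.
have aJ : 0 < alpha * J + 1 by rewrite ltr_wpDl.
exists (Num.min (eta / 2) (e / 2 / (alpha * J + 1))).
  by rewrite lt_min eta20 divr_gt0.
move=> x xH; rewrite le_min => /andP[xx0 xe].
have xp : 0 < xlast x by [].
have xl : xlast x <= e / 2 / (alpha * J + 1).
  apply: le_trans xe; apply: le_trans (coord_enorm (x - x0) ord_max).
  by rewrite !mxE -/(xlast x) -/(xlast x0) x00 subr0 ler_norm.
have xrho : enorm x <= rho.
  rewrite -[x](subrK x0) (le_trans (enormD _ _))// addrC lerD2l.
  by rewrite (le_trans xx0)//; lra.
have bx : enorm (bproj x - y0) <= eta / 2.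
  apply: le_trans xx0; apply: le_trans (enorm_bproj _).
  by rewrite /y0 (_ : _ - _ = bproj (x - x0))//; apply/rowP => i; rewrite !mxE.
have [iK mass] := poisson_mass d_gt0 xH.
have iG := kint_int xH.
have pointwise y : `|f y * G M d.+1 x y - f y0 * K x y| <= e / 2 * K x y + h y.
  have K0 := sqrtVX_ge0 d.+1 (sqdist x y).
  have wt0 := weight_ge0 d.+1 y.
  have h1 : 0 <= C1 * `|f y * weight (M + d.+1) y| by rewrite mulr_ge0.
  have fe : 0 <= `|f y0| + e / 2 by rewrite addr_ge0 ?(ltW e20).
  have [yy0|yy0] := leP (enorm (y - y0)) eta.
    have -> : f y * G M d.+1 x y - f y0 * K x y =
        (f y - f y0) * K x y - f y * (w y * tpoly M d.+1 x y).
      by rewrite /mkernel; ring.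
    rewrite (le_trans (ler_normB _ _))// lerD//.
      by rewrite normrM (ger0_norm K0) ler_wpM2r// f_eta.
    rewrite ler_wpDl// normrM /C4 mulrDl ler_wpDr ?mulr_ge0//.
    apply: (@le_trans _ _ ((`|f y0| + e / 2) * C3)).
      apply: ler_pM => //; last exact: H3.
      rewrite -[f y](subrK (f y0)) addrC (le_trans (ler_normD _ _))//.
      by rewrite lerD2l f_eta.
    rewrite -[X in X <= _]mulr1 -[X in _ <= X]mulrA ler_wpM2l ?mulr_ge0//.
    rewrite -ler_pdivrMl ?mulr1; last by rewrite ltr_wpDl ?exprn_ge0.
    apply: weight_lb; rewrite -[y](subrK y0) (le_trans (enormD _ _))//.
    by rewrite addrC lerD2l (le_trans yy0).
  (* bproj x is within eta / 2 of y0, and y is not within eta of it *)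
  have far : (eta / 2) ^+ 2 <= sqdist x y.
    rewrite sqdistE ler_wpDr ?sqr_ge0//.
    rewrite lerXn2r ?nnegrE ?enorm_ge0 ?(ltW eta20)//.
    have := enormD (y - bproj x) (bproj x - y0).
    rewrite addrA subrK; lra.
  rewrite ler_wpDl ?(mulr_ge0 (ltW e20) K0)//.
  rewrite (le_trans (ler_normB _ _))// lerD//.
    rewrite !normrM (ger0_norm (weight_ge0 _ _)) mulrCA ler_wpM2l//.
    exact: H1.
  rewrite normrM /C4 mulrDl ler_wpDl ?(mulr_ge0 C50 wt0)//.
  rewrite -mulrA ler_wpM2l//.
  by have := H2 x y xrho far; rewrite /mkernel /tpoly big_ord0 mulr0 subr0.
have -> : alpha * (xlast x * kint w f M d.+1 x) - f y0 =
    alpha * xlast x * \int[mu]_y (f y * G M d.+1 x y - f y0 * K x y).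
  rewrite RintegralB//; last exact: (integrableZl measurableT (f y0) iK).
  rewrite (RintegralZl (f y0) measurableT iK) mulrBr -/(kint _ _ _ _ _) mulrA.
  by congr (_ - _); rewrite mulrCA mass mulr1.
have iGK := integrableB measurableT iG (integrableZl measurableT (f y0) iK).
have ieK := integrableZl measurableT (e / 2) iK.
have axl0 : 0 <= alpha * xlast x by exact: (mulr_ge0 a0 (ltW xp)).
rewrite normrM (ger0_norm axl0).
apply: (@le_trans _ _ (alpha * xlast x * (e / 2 * \int[mu]_y K x y + J))).
  rewrite ler_wpM2l//.
  rewrite (le_trans (le_normr_Rintegral measurableT iGK))//.
  rewrite -(RintegralZl (e / 2) measurableT iK) -(RintegralD measurableT ieK ih).
  apply: le_Rintegral => //; first exact: (integrable_abse iGK).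
  exact: (integrableD measurableT ieK ih).
rewrite mulrDr mulrCA mass mulr1 [X in _ <= X](splitr e) lerD2l.
rewrite mulrAC; apply: (@le_trans _ _ ((alpha * J + 1) * xlast x)).
  by rewrite ler_wpM2r ?(ltW xp)// lerDl.
by rewrite mulrC -ler_pdivlMr.
Qed.

(** The extension of u by f. Using f (bproj x) below the boundary as well makes it
    continuous on the whole space. *)
Definition dirichlet_solution x : R :=
  if 0 < xlast x then alpha * (xlast x * kint w f M d.+1 x) else f (bproj x).

Lemma dirichlet_solution_continuous : continuous dirichlet_solution.
Proof.
move=> x; have [xH|xN] := ltP 0 (xlast x).
  have pE z : half_space z -> dirichlet_solution z = alpha * (xlast z * kint w f M d.+1 z).
    by rewrite /half_space/= /dirichlet_solution => ->.
  have kE : kernel_class w (fun z => alpha * (xlast z * kint w f M d.+1 z)).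
    apply: kernel_class_mul; first exact: kernel_class_cst.
    by apply: kernel_class_mul; [exact: kernel_class_coord|exact: kernel_class_kint].
  have kc := kernel_class_continuous w_meas w_range w_eq0 w_eq1 kE.
  exact: (continuous_on_eq pE kc xH).
apply: (@continuous_at_dist R 'rV[R]_d.+1) => e e0.
have pxE : dirichlet_solution x = f (bproj x) by rewrite /dirichlet_solution ltNge xN.
have [eta /andP[eta0 _] f_eta] := f_near (bproj x) e0.
have [dl dl0 lim_dl] : exists2 dl : R, 0 < dl & forall z, half_space z ->
    enorm (z - x) <= dl ->
    `|alpha * (xlast z * kint w f M d.+1 z) - f (bproj x)| <= e.
  move: xN; rewrite le_eqVlt => /predU1P[x0|xN]; first exact: poisson_limit.
  exists (- xlast x / 2) => [|z zH zx]; first by rewrite divr_gt0// oppr_gt0.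
  have z0 : 0 < xlast z by [].
  have := le_trans (ler_norm _) (le_trans (coord_enorm (z - x) ord_max) zx).
  by rewrite !mxE -/(xlast z) -/(xlast x) => ?; exfalso; lra.
have ch : {for x, continuous (fun z : 'rV[R]_d.+1 => enorm (z - x))}.
  exact: enorm_sub_continuous.
have h0 : 0 < Num.min eta dl by rewrite lt_min eta0.
near=> z; have : enorm (z - x) <= Num.min eta dl.
  near: z; apply: (cvgr_le _ ch).
  by rewrite subrr /enorm edot0l sqrtr0.
rewrite le_min distrC pxE /dirichlet_solution => /andP[z1 z2]; case: ifPn => [zH|_].
  exact: lim_dl.
apply: f_eta; rewrite (_ : _ - _ = bproj (z - x)).
  exact: le_trans (enorm_bproj _) z1.
by apply/rowP => i; rewrite !mxE.
Unshelve. all: by end_near. Qed.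

(** Divided by |x|^(M+1) sec^d, the integrand is at most
    |f| min (C1 weight, C2 / |x|), which decreases pointwise to 0 as |x| grows and
    is dominated by a multiple of |f| weight. *)
Lemma poisson_growth (e : R) : 0 < e -> exists r0 : R,
  forall x, half_space x -> r0 <= enorm x ->
    `|alpha * (xlast x * kint w f M d.+1 x)|
      <= e * (enorm x ^+ M.+1 * (enorm x / xlast x) ^+ d).
Proof.
move=> e0; have a0 := alpha_ge0.
have [C1 C10 H1] := growth_bound_decay w_range w_eq0 w_eq1 M.
have [C2 C20 H2] := growth_bound_flat w_range w_eq0 M.
have [f_meas ifw] := f_wint.
pose g y := C1 * weight (M + d.+1) y.
have g0 y : 0 <= g y by rewrite mulr_ge0 ?weight_ge0.
pose h (k : nat) y := `|f y| * Num.min (g y) (C2 / k.+1%:R).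
have mg : measurable_fun setT g.
  by apply: measurable_funM => //; exact: measurable_weight.
have mh k : measurable_fun setT (h k).
  apply: measurable_funM; first exact: measurableT_comp.
  exact: measurable_minr.
have h0 k y : 0 <= h k y.
  by rewrite mulr_ge0// le_min g0/= divr_ge0.
have ig : mu.-integrable setT (fun y => (C1 * `|f y * weight (M + d.+1) y|)%:E).
  exact: (integrableZl measurableT C1 (integrable_abse ifw)).
have hg k y : h k y <= C1 * `|f y * weight (M + d.+1) y|.
  rewrite normrM (ger0_norm (weight_ge0 _ _)) mulrCA ler_wpM2l//.
  by rewrite ge_min lexx.
have ih k : mu.-integrable setT (EFin \o h k).
  apply: le_integrable ig => //; first exact/measurable_EFinP.
  move=> y _; rewrite !abse_EFin lee_fin [`|h k y|]ger0_norm ?h0//.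
  exact: le_trans (hg k y) (ler_norm _).
have h_cvg y : h k y @[k --> \oo] --> (0 : R).
  apply: (@squeeze_cvgr _ _ _ _ (cst 0) (fun k => `|f y| * C2 * k.+1%:R^-1)).
  - near=> k; rewrite h0/= -mulrA ler_wpM2l//.
    by rewrite ge_min lexx orbT.
  - exact: cvg_cst.
  - rewrite -[X in _ --> X](mulr0 (`|f y| * C2)).
    by apply: cvgM; [exact: cvg_cst|exact: cvg_harmonic].
have hE (k : nat) : measurable_fun setT (fun y => (h k y)%:E).
  exact/measurable_EFinP.
have c0 : measurable_fun setT (cst 0%E : 'rV[R]_d -> \bar R).
  exact: measurable_cst.
have h_ae : {ae mu, forall y, setT y -> (h k y)%:E @[k --> \oo] --> cst 0%E y}.
  apply: aeW => y _; apply/fine_cvgP; split; first exact: nearW.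
  exact: h_cvg.
have hg_ae : {ae mu, forall y (k : nat), setT y ->
    (`|(h k y)%:E| <= (C1 * `|f y * weight (M + d.+1) y|)%:E)%E}.
  by apply: aeW => y k _; rewrite abse_EFin lee_fin ger0_norm ?h0.
have [_ _ hlim] := dominated_convergence measurableT hE c0 h_ae ig hg_ae.
have hl0 : \int[mu]_y h k y @[k --> \oo] --> (0 : R).
  move: hlim; rewrite integral0 => /fine_cvgP[_]; exact.
have e1 : 0 < e / (alpha + 1) by rewrite divr_gt0// ltr_wpDl.
have [k hk] : exists k, \int[mu]_y h k y <= e / (alpha + 1).
  have [k _ hk] := cvgr_le _ hl0 _ e1.
  by exists k; apply: hk => /=.
exists k.+1%:R => x xH kx.
have xp : 0 < xlast x by [].
have x1 : 1 <= enorm x by apply: le_trans kx; rewrite ler1n.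
have e00 : 0 < enorm x by apply: lt_le_trans x1.
set om := enorm x ^+ M.+1 * _.
have om0 : 0 <= om.
  by rewrite mulr_ge0 ?exprn_ge0 ?divr_ge0 ?enorm_ge0 ?(ltW xp).
have bound y : `|f y * (xlast x * G M d.+1 x y)| <= om * h k y.
  rewrite normrM /h mulrCA ler_wpM2l//.
  rewrite /Num.min; case: ifP => _.
    rewrite (le_trans (H1 _ y xH x1))// /g /om.
    by rewrite [X in _ <= X]mulrCA [X in _ <= X]mulrA.
  rewrite (le_trans (H2 _ y xH x1))// [X in _ <= X]mulrCA ler_wpM2l//.
  rewrite ler_pdivlMr// [X in X <= _]mulrC /om exprS -mulrA ler_wpM2r//.
  by rewrite mulr_ge0 ?exprn_ge0 ?divr_ge0 ?enorm_ge0 ?(ltW xp).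
have iG := kint_int xH.
have ixG : mu.-integrable setT (fun y => (f y * (xlast x * G M d.+1 x y))%:E).
  have := integrableZl measurableT (xlast x) iG.
  by apply: eq_integrable => // y _; rewrite -EFinM mulrCA.
have -> : xlast x * kint w f M d.+1 x =
    \int[mu]_y (f y * (xlast x * G M d.+1 x y)).
  rewrite /kint -(RintegralZl (xlast x) measurableT iG).
  by apply: eq_Rintegral => y _; rewrite mulrCA.
rewrite normrM (ger0_norm a0).
apply: (@le_trans _ _ (alpha * (om * (e / (alpha + 1))))).
  apply: ler_wpM2l => //.
  apply: (@le_trans _ _ (om * \int[mu]_y h k y)); last exact: ler_wpM2l.
  rewrite (le_trans (le_normr_Rintegral measurableT ixG))//.
  rewrite -(RintegralZl om measurableT (ih k)); apply: le_Rintegral => //.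
    exact: (integrable_abse ixG).
  exact: (integrableZl measurableT om (ih k)).
rewrite mulrCA [X in _ <= X]mulrC; apply: ler_wpM2l => //.
have a1 : 0 < alpha + 1 by rewrite ltr_wpDl.
rewrite mulrCA -[X in _ <= X]mulr1; apply: ler_wpM2l; first exact: ltW.
by rewrite ler_pdivrMr// mul1r lerDl.
Unshelve. all: by end_near. Qed.

End poisson_extension.

(** * The Dirichlet problem in the half space *)

Unset Implicit Arguments.

Theorem corollary2p1 (R : realType) (d : nat) (hd : (1 <= d)%N) (M : nat)
    (w : 'rV[R]_d -> R) (w_cont : continuous w)
    (w_range : forall y, 0 <= w y <= 1)
    (w_eq0 : forall y, enorm y <= 1 -> w y = 0)
    (w_eq1 : forall y, 2 <= enorm y -> w y = 1)
    (f : 'rV[R]_d -> R) (f_cont : continuous f)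
    (f_int : (\int[lebesgue_row d]_y
                (`|f y| / (enorm y ^+ (M + d.+1) + 1))%:E < +oo)%E) :
  let wf : 'rV[R]_d -> R := fun y => w y * f y in
  let wcf : 'rV[R]_d -> R := fun y => (1 - w y) * f y in
  let u : 'rV[R]_d.+1 -> R := fun x => DM_integral M wf x + D_integral wcf x in
  (forall x : 'rV[R]_d.+1, half_space x ->
     (lebesgue_row d).-integrable [set: 'rV[R]_d]
       (fun y => (wf y * kernelKM M (d.+1%:R / 2) x y)%:E) /\
     (lebesgue_row d).-integrable [set: 'rV[R]_d]
       (fun y => (wcf y * kernelK (d.+1%:R / 2) x y)%:E)) /\
  C2_on half_space u /\
  (exists v : 'rV[R]_d.+1 -> R,
     {within closure half_space, continuous v} /\
     (forall x, half_space x -> v x = u x) /\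
     (forall x, xlast x = 0 -> v x = f (bproj x))) /\
  (forall x, half_space x -> laplacian u x = 0) /\
  little_o_half_space u
    (fun x => enorm x ^+ M.+1 * (cos (polar_angle x))^-1 ^+ d).
Proof.
have w_meas : measurable_fun setT w by exact: continuous_measurable_row.
have f_meas : measurable_fun setT f by exact: continuous_measurable_row.
have f_wint : wintegrable (M + d.+1) f.
  split => //; apply/integrableP; split.
    by apply/measurable_EFinP/measurable_funM => //; exact: measurable_weight.
  rewrite (eq_integral (fun y => (`|f y| / (enorm y ^+ (M + d.+1) + 1))%:E))//.
  by move=> y _; rewrite abse_EFin normrM (ger0_norm (weight_ge0 _ _)).
move=> wf wcf u.
have uE x : half_space x ->
    u x = alpha_const d.+1 * (xlast x * kint w f M d.+1 x).
  by move=> xH; apply: poisson_extensionE.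
have uk : kernel_class w (fun x => alpha_const d.+1 * (xlast x * kint w f M d.+1 x)).
  apply: kernel_class_mul; first exact: kernel_class_cst.
  by apply: kernel_class_mul; [exact: kernel_class_coord|exact: kernel_class_kint].
split; [|split; [|split; [|split]]].
- move=> x xH; split; first exact: cutoff_integrable.
  have := cutoff_complement_integrable w_meas w_range w_eq1 f_wint xH.
  by apply: eq_integrable => // y _; rewrite kernelK_sqrtVX.
- exact: (kernel_class_C2 w_meas w_range w_eq0 w_eq1 uk uE).
- exists (dirichlet_solution w M f); split; [|split].
  + apply: continuous_subspaceT.
    exact: dirichlet_solution_continuous.
  + by move=> x xH; rewrite uE// /dirichlet_solution (xH : 0 < xlast x).
  + by move=> x x0; rewrite /dirichlet_solution x0 ltxx.
- by move=> x xH; apply: (kint_harmonic w_meas w_range w_eq0 w_eq1 f_wint uE xH).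
pose om (x : 'rV[R]_d.+1) : R := enorm x ^+ M.+1 * (cos (polar_angle x))^-1 ^+ d.
rewrite -/om /little_o_half_space.
have omE (x : 'rV[R]_d.+1) : half_space x ->
    om x = enorm x ^+ M.+1 * (enorm x / xlast x) ^+ d.
  by move=> xH; rewrite /om cos_polar_angle// invf_div.
have om_gt0 (x : 'rV[R]_d.+1) : half_space x -> 0 < om x.
  move=> xH; have e0 := half_space_enorm_gt0 xH.
  by rewrite omE// mulr_gt0 ?exprn_gt0// divr_gt0.
have sup_ge0 (r : R) : 0 < r ->
    (0 <= ereal_sup [set (`|u x| / om x)%:E |
             x in half_space `&` [set x | enorm x = r]])%E.
  move=> r0; pose x : 'rV[R]_d.+1 := r *: delta_mx ord0 ord_max.
  have xr : xlast x = r by rewrite /xlast !mxE !eqxx mulr1.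
  have xH : half_space x by rewrite /half_space/= xr.
  apply: (@le_trans _ _ (`|u x| / om x)%:E).
    by rewrite lee_fin divr_ge0// ltW// om_gt0.
  apply: ereal_sup_ubound; exists x => //; split => //=.
  rewrite enormZ (gtr0_norm r0) /enorm edot_dir mxE !eqxx sqrtr1 mulr1//.
have sup_le (e : R) : 0 < e -> exists r0 : R, forall r, r0 <= r ->
    (ereal_sup [set (`|u x| / om x)%:E |
             x in half_space `&` [set x | enorm x = r]] <= e%:E)%E.
  move=> e0; have [r0 gr0] := poisson_growth hd w_meas w_range w_eq0 w_eq1 f_wint e0.
  exists r0 => r r0r; apply: ge_ereal_sup => _ [x [xH /= xr] <-].
  rewrite lee_fin ler_pdivrMr ?om_gt0// uE// omE//.
  by apply: gr0 => //; rewrite xr.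
apply/fine_cvgP; split.
  have [r0 hr0] := sup_le 1 ltr01.
  near=> r; rewrite ge0_fin_numE; last first.
    by apply: sup_ge0; near: r; exact: nbhs_pinfty_gt.
  apply: le_lt_trans (hr0 r _) (ltry _).
  by near: r; apply: nbhs_pinfty_ge; rewrite num_real.
apply/cvgrPdist_le => e e0; have [r0 hr0] := sup_le e e0.
near=> r; rewrite sub0r normrN /=.
have r_gt0 : 0 < r by near: r; exact: nbhs_pinfty_gt.
have sup_e : (ereal_sup [set (`|u x| / om x)%:E |
             x in half_space `&` [set x | enorm x = r]] <= e%:E)%E.
  by apply: hr0; near: r; apply: nbhs_pinfty_ge; rewrite num_real.
rewrite ger0_norm ?fine_ge0 ?sup_ge0//.
rewrite -lee_fin fineK// ge0_fin_numE ?sup_ge0//.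
exact: le_lt_trans sup_e (ltry _).
Unshelve. all: by end_near. Qed.
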